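(* Let $q\ge 0$ be real and let $X=(x_i)$, $Y=(y_j)$ be finite alphabets of nonnegative real numbers with $\max\{1,q\}\,x_iy_j<1$ for all $i,j$. For strict partitions $\mu,\lambda$ put $$K_X^Y(\mu,\lambda)=\frac{Q_{\lambda/\mu}(X)P_\lambda(Y)}{\mathsf H(X;Y)P_\mu(Y)}\ \text{ if }\mu\subseteq\lambda,\qquad K_X^Y(\mu,\lambda)=0\ \text{ if }\mu\nsubseteq\lambda,$$ and $$\pi_{qX,Y}(\mu)=\frac{Q_\mu(qX)P_\mu(Y)}{\mathsf H(qX;Y)}.$$ Then for every $\mu$ in the support of the distribution $\pi_{qX,Y}$, $$\sum_{\lambda\in\mathrm{SP}}K_X^Y(\mu,\lambda)=1.$$ Moreover, $$\mathbb P_q^{X,Y}(\mu,\lambda)=\pi_{qX,Y}(\mu)\,K_X^Y(\mu,\lambda),$$ where $\mathbb P_q^{X,Y}$ is the probability measure on pairs of strict partitions with $\mathbb P_q^{X,Y}(\mu,\lambda)=\dfrac{Q_\mu(qX)Q_{\lambda/\mu}(X)P_\lambda(Y)}{\mathsf H(qX;Y)\mathsf H(X;Y)}$ if $\mu\subseteq\lambda$ and $0$ otherwise.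
   Context: $\mathrm{SP}$ is the set of strict partitions; $\mu\subseteq\lambda$ means $\mu_i\le\lambda_i$ for all $i$ after appending zeros. For an alphabet $A$, $p_n(A)$ is the $n$-th power sum. $A+B$ denotes the union of alphabets, so $p_n(A+B)=p_n(A)+p_n(B)$; $qX=(qx_i)$. Schur $Q$- and $P$-functions are the standard ones (Macdonald, Ch. III.8): with $\sum_{r\ge0}q_r(A)z^r=\prod_{a\in A}\frac{1+az}{1-az}$, one has $Q_{(r)}=q_r$, $Q_{(r,s)}=q_rq_s+2\sum_{i\ge1}(-1)^iq_{r+i}q_{s-i}$ for $r>s\ge0$, and $Q_\lambda$ is the Pfaffian of the skew-symmetric matrix with upper entries $Q_{(\lambda_i,\lambda_j)}$, $i<j$ (a zero part is appended to $\lambda$ if its length is odd); $P_\lambda=2^{-\ell(\lambda)}Q_\lambda$. Skew $Q$-functions are determined by $Q_\lambda(A+B)=\sum_{\mu\subseteq\lambda}Q_{\lambda/\mu}(A)Q_\mu(B)$. $\mathsf H(A;B)=\exp\Big(2\sum_{n\ge1,\ n\text{ odd}}\frac{p_n(A)p_n(B)}{n}\Big)$, which for finite alphabets equals $\prod_{a\in A,b\in B}\frac{1+ab}{1-ab}$. The formula for $K_X^Y(\mu,\cdot)$ is used on the support of $\pi_{qX,Y}$; rows with $P_\mu(Y)=0$ have $\pi_{qX,Y}(\mu)=0$ and may be assigned arbitrarily. $\pi_{qX,Y}$ is the $\mu$-marginal of $\mathbb P_q^{X,Y}$. *)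

(* Defs.v *)
From HB Require Import structures.
From mathcomp Require Import all_boot all_order all_algebra all_fingroup.
From mathcomp Require Import all_classical all_reals all_analysis.

Set Implicit Arguments.
Unset Strict Implicit.
Unset Printing Implicit Defensive.

Import Order.TTheory GRing.Theory Num.Theory.
Import numFieldNormedType.Exports.

Local Open Scope classical_set_scope.
Local Open Scope ring_scope.

Record strict_partition := StrictPartition {
  parts :> seq nat;
  _ : sorted gtn parts && (0%N \notin parts) }.

HB.instance Definition _ := [isSub for parts].
HB.instance Definition _ := [Countable of strict_partition by <:].

Definition contained (mu la : strict_partition) : Prop :=
  forall i, (nth 0 mu i <= nth 0 la i)%N.

Section SchurQ.
Variable R : realType.

(** A finite alphabet is a sequence of reals; the order is irrelevant, the
    union [A + B] is the concatenation [A ++ B]. *)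
Implicit Types (A B X Y : seq R) (la mu : strict_partition).

Definition scale_alphabet (q : R) X : seq R := [seq q * x | x <- X].

Definition psum (n : nat) A : R := \sum_(a <- A) a ^+ n.

Definition Hker A B : R :=
  expR (2 * limn (fun N : nat =>
    \sum_(1 <= n < N | odd n) psum n A * psum n B / n%:R)).

(** Formal power series are represented by their coefficient sequences. *)
Definition cauchy_prod (f g : nat -> R) (n : nat) : R :=
  \sum_(i < n.+1) f i * g (n - i)%N.

(** [(1 + a z) / (1 - a z)], where [1 / (1 - a z)] is the series of the
    [a ^+ i]. *)
Definition qfactor (a : R) : nat -> R :=
  cauchy_prod (fun i => (1 + a *: 'X : {poly R})`_i) (fun i => a ^+ i).

Definition qfun (r : nat) A : R :=
  foldr (fun a => cauchy_prod (qfactor a)) (fun i => (i == 0)%:R) A r.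

(** The terms with [i > s] vanish, since [q_n = 0] for [n < 0]. *)
Definition Q2 (r s : nat) A : R :=
  qfun r A * qfun s A +
  2 * \sum_(1 <= i < s.+1) (-1) ^+ i * qfun (r + i) A * qfun (s - i) A.

(** Meant for even [n]: the entries multiplied together are those at
    [(s 0, s 1), (s 2, s 3), ...], with indices counted from 0. *)
Definition pfaffian (n : nat) (M : 'M[R]_n) : R :=
  (2 ^+ n./2 * (n./2)`!%:R)^-1 *
  \sum_(s : 'S_n) (-1) ^+ s * \prod_(i < n | ~~ odd i) M (s i) (s (ordS i)).

(** The default value of [nth] supplies the appended zero part. *)
Definition Qmatrix la A : 'M[R]_(size la + odd (size la)) :=
  \matrix_(i, j)
    if (i < j)%N then Q2 (nth 0%N la i) (nth 0%N la j) A
    else if (j < i)%N then - Q2 (nth 0%N la j) (nth 0%N la i) A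
    else 0.

Definition Qfun la A : R := pfaffian (Qmatrix la A).

Definition Pfun la A : R := 2 ^- size la * Qfun la A.

(** [c mu = Q_{la/mu}(A)] for all [mu]; the functions [Q_mu] of a finite
    alphabet being linearly independent, there is at most one such [c]. *)
Definition is_skewQ la A (c : strict_partition -> R) : Prop :=
  (forall mu, ~ contained mu la -> c mu = 0) /\
  (forall B, Qfun la (A ++ B) =
     \sum_(mu \in [set mu | contained mu la]) c mu * Qfun mu B).

Definition skewQ la mu A : R := xget (fun=> 0) [set c | is_skewQ la A c] mu.

Definition Kker X Y mu la : R :=
  if `[< contained mu la >]
  then skewQ la mu X * Pfun la Y / (Hker X Y * Pfun mu Y) else 0.

Definition pi_dist (q : R) X Y mu : R :=
  Qfun mu (scale_alphabet q X) * Pfun mu Y / Hker (scale_alphabet q X) Y.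

Definition Pq (q : R) X Y mu la : R :=
  if `[< contained mu la >]
  then Qfun mu (scale_alphabet q X) * skewQ la mu X * Pfun la Y /
       (Hker (scale_alphabet q X) Y * Hker X Y) else 0.

(** Nonnegativity is part of the definition, and [esum] is the sum of a family
    only when the terms are nonnegative. *)
Definition is_prob_mass (T : choiceType) (f : T -> R) : Prop :=
  (forall t, 0 <= f t) /\ (\esum_(t in [set: T]) (f t)%:E = 1)%E.

End SchurQ.

(* Main.v *)
Require Import Defs.
From HB Require Import structures.
From mathcomp Require Import all_boot all_order all_algebra all_fingroup.
From mathcomp Require Import all_classical all_reals all_analysis.
From mathcomp Require Import ring lra zify.

Set Implicit Arguments.
Unset Strict Implicit.
Unset Printing Implicit Defensive.

Import Order.TTheory GRing.Theory Num.Theory.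
Import numFieldNormedType.Exports.

Local Open Scope classical_set_scope.
Local Open Scope ring_scope.

(** The theorem rests on the skew Cauchy identity
      [sum_la Q_{la/mu}(X) P_la(Y) = H(X; Y) P_mu(Y)]
    ([skew_Cauchy]), in which all terms are nonnegative. Divided by its right
    side, it says that the rows of the kernel sum to 1. Multiplied by
    [Q_mu(qX)] and summed over [mu], it reduces the total mass of the measure
    to [sum_mu Q_mu(qX) P_mu(Y) = H(qX; Y)], which is the identity for the
    alphabet [qX] and the empty partition. When [P_mu(Y) = 0], it forces each
    [Q_{la/mu}(X) P_la(Y)] to vanish, and this is the factorization of the
    measure where the kernel has a zero denominator.

    Everything else is done one variable at a time. The branching rule
    [Q_la(x, B) = sum_mu T_x(la, mu) Q_mu(B)] ([Qseq_branching]) has weights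
    that a two-state automaton reads off the parts of [la] and [mu]
    ([transfer]). It comes from the Pfaffian: adding the variable [x] replaces
    the row of a part [a] by a combination of the rows of the integers at most
    [a], the Pfaffian is multilinear and alternating in these rows, and the
    alternation cancels all terms but those where [mu] interlaces with [la]
    ([lower_all_straighten]).

    Iterating the branching rule gives an expansion of [Q_la(A + B)] with
    nonnegative coefficients. As the [Q_mu] are linearly independent
    ([Qseq_free]), these are the skew functions ([skewQE]).

    The weights of [Q] at [x] and of [P] at [y] commute up to the factor
    [(1 + x y) / (1 - x y)] ([one_var_commute]); for finite sums this is a
    relation preserved by each step of the automaton ([above_below]), and the
    factor arises from the geometric series of the unbounded parts. Induction
    on [Y], then on [X], gives the skew Cauchy identity with the product of
    these factors, which is [H(X; Y)] by the power series of the
    logarithm ([Hker_prod]). *)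

(** * Pfaffians of matrices *)

Section Pfaffians.
Variable R : realType.

Definition pf_term n (M : 'M[R]_n) (s : 'S_n) : R :=
  (-1) ^+ s * \prod_(i < n | ~~ odd i) M (s i) (s (ordS i)).

Lemma pfaffian_perm n (t : 'S_n) (M : 'M[R]_n) :
  pfaffian (\matrix_(i, j) M (t i) (t j)) = (-1) ^+ t * pfaffian M.
Proof.
rewrite /pfaffian [RHS]mulrCA; congr (_ * _).
rewrite [in RHS](reindex_inj (mulIg t)) big_distrr /=.
apply: eq_bigr => s _; rewrite odd_permM signr_addb mulrA mulrCA.
rewrite -signr_addb addbb mulr1.
by congr (_ * _); apply: eq_bigr => i _; rewrite mxE !permM.
Qed.

Lemma val_ordS_even n (i : 'I_n) : ~~ odd n -> ~~ odd i -> ordS i = i.+1 :> nat.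
Proof.
move=> n_even i_even /=; rewrite modn_small // ltn_neqAle ltn_ord andbT.
by apply: contraNneq n_even => <- /=; rewrite i_even.
Qed.

(** A Pfaffian term uses each index exactly once, in a single factor, so a
    Pfaffian is linear in the row and column of an index [k] taken together. *)
Lemma pfaffian_linear n (k : 'I_n) (M : 'M[R]_n) (I : Type) (r : seq I)
    (c : I -> R) (N : I -> 'M[R]_n) :
    ~~ odd n ->
    (forall j a b, a != k -> b != k -> N j a b = M a b) ->
    (forall a, a != k -> M k a = \sum_(j <- r) c j * N j k a) ->
    (forall a, a != k -> M a k = \sum_(j <- r) c j * N j a k) ->
  pfaffian M = \sum_(j <- r) c j * pfaffian (N j).
Proof.
move=> n_even eqN rowM colM; rewrite /pfaffian.
under [RHS]eq_bigr do rewrite mulrCA big_distrr.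
rewrite -big_distrr exchange_big /=; congr (_ * _); apply: eq_bigr => s _.
under [RHS]eq_bigr do rewrite mulrCA.
rewrite -big_distrr /=; congr (_ * _).
have ordS_neq (i : 'I_n) : ~~ odd i -> ordS i != i.
  by move=> i_even; rewrite -(inj_eq (@ord_inj _)) val_ordS_even //; apply/eqP; lia.
have sneq (i j : 'I_n) : s j = k -> i != j -> s i != k.
  by move=> <-; apply: contraNneq => /perm_inj ->.
set p := (s^-1)%g k; have sp : s p = k by rewrite /p permKV.
have [p_odd|p_even] := boolP (odd p).
  have p_gt0 : (0 < p)%N by case: (nat_of_ord p) p_odd.
  have pred_lt : (p.-1 < n)%N by rewrite (leq_ltn_trans (leq_pred p)).
  pose i0 := Ordinal pred_lt; have i0_even : ~~ odd i0.
    by move: p_odd; rewrite /= -{1}(prednK p_gt0).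
  have Si0 : ordS i0 = p by apply/ord_inj; rewrite val_ordS_even //= prednK.
  rewrite (bigD1 i0) //= Si0 sp colM; last first.
    by apply: sneq (sp) _; rewrite -Si0 eq_sym ordS_neq.
  rewrite mulr_suml; apply: eq_bigr => j _; rewrite [in RHS](bigD1 i0) //=.
  rewrite Si0 sp -mulrA; congr (_ * (_ * _)); apply: eq_bigr => i.
  case/andP=> i_even ii0; rewrite eqN //; apply: sneq (sp) _.
    by apply: contraNneq i_even => ->; rewrite p_odd.
  rewrite -Si0; apply: contraNneq ii0 => eqS; rewrite -(inj_eq (@ord_inj _)) /=.
  by have:= congr1 (@nat_of_ord _) eqS; rewrite !val_ordS_even // => -[/eqP].
rewrite (bigD1 p) //= sp rowM; last by apply: sneq (sp) _; rewrite ordS_neq.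
rewrite mulr_suml; apply: eq_bigr => j _; rewrite [in RHS](bigD1 p) //=.
rewrite sp -mulrA; congr (_ * (_ * _)); apply: eq_bigr => i.
case/andP=> i_even ip; rewrite eqN //; apply: sneq (sp) _ => //.
by rewrite -(inj_eq (@ord_inj _)) val_ordS_even //; apply: contraNneq i_even; move: p_even; lia.
Qed.

(** An even permutation of the blocks [(0, 1), (2, 3), ...] only reorders the
    factors of a Pfaffian term. *)
Lemma pf_term_pair_perm n (M : 'M[R]_n) (t s : 'S_n) :
    t = false :> bool -> (forall i : 'I_n, odd (t i) = odd i) ->
    (forall i : 'I_n, ~~ odd i -> t (ordS i) = ordS (t i)) ->
  pf_term M (t * s)%g = pf_term M s.
Proof.
move=> t_even parity tS; rewrite /pf_term odd_permM t_even; congr (_ * _).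
rewrite [RHS](reindex_inj (@perm_inj _ t)) /=; apply: eq_big => i.
  by rewrite parity.
by move=> i_even; rewrite !permM tS.
Qed.

(** Exchanging the two positions of a block changes the sign of the
    permutation and, by antisymmetry, the sign of one factor. *)
Lemma pf_term_flip n (M : 'M[R]_n) (j : 'I_n) (s : 'S_n) :
    ~~ odd n -> ~~ odd j -> (forall a b, M a b = - M b a) ->
  pf_term M (tperm j (ordS j) * s)%g = pf_term M s.
Proof.
move=> n_even j_even Manti.
have jS : j != ordS j by rewrite -(inj_eq (@ord_inj _)) val_ordS_even //; apply/eqP; lia.
rewrite /pf_term odd_permM odd_tperm jS signr_addb expr1 mulN1r.
rewrite (bigD1 j) //= [in RHS](bigD1 j) //=.
rewrite !permM tpermL tpermR Manti !mulNr mulrN opprK; congr (_ * (_ * _)).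
apply: eq_bigr => i /andP[i_even ij]; rewrite !permM !tpermD //.
- by rewrite -(inj_eq (@ord_inj _)) val_ordS_even //; apply: contraNneq j_even; move: i_even; lia.
- rewrite -(inj_eq (@ord_inj _)) !val_ordS_even // eqSS.
  by rewrite (inj_eq (@ord_inj _)) eq_sym.
- by rewrite eq_sym.
- by rewrite -(inj_eq (@ord_inj _)) val_ordS_even //; apply: contraNneq i_even => <-; move: j_even; lia.
Qed.

(** Row [u] has the single nonzero entry [M u v], so only the permutations that
    pair [u] with [v] contribute. By the two symmetries above, the sum over
    those that do it at a given position is independent of the position;
    there are [n.+2] positions, and this number is the ratio of the two
    normalizing constants. *)
Lemma pfaffian_border n (M : 'M[R]_n.+2)
    (v := ord_max : 'I_n.+2) (u := lift v ord_max : 'I_n.+2) :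
    ~~ odd n -> (forall a b, M a b = - M b a) ->
    (forall a, a != v -> M u a = 0) -> M u v = 1 ->
  pfaffian M = pfaffian (\matrix_(i < n, j < n) M (lift v (lift ord_max i))
                                          (lift v (lift ord_max j))).
Proof.
move=> n_even Manti Mu0 Muv1; set N := (X in _ = pfaffian X).
have n2_even : ~~ odd n.+2 by rewrite /= negbK.
have u_val : u = n :> nat by rewrite lift_max.
have u_even : ~~ odd u by rewrite u_val.
have Su : ordS u = v by apply/ord_inj; rewrite val_ordS_even // u_val.
have uv : u != v by rewrite -(inj_eq (@ord_inj _)) u_val /=; apply/eqP; lia.
pose S0 := \sum_(s : 'S_n.+2 | (s u == u) && (s v == v)) pf_term M s.
(* Swapping the block of [p] with the last block is an even permutation. *)
have even_block (p : 'I_n.+2) : ~~ odd p ->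
    \sum_(s : 'S_n.+2 | (s p == u) && (s (ordS p) == v)) pf_term M s = S0.
  move=> p_even; pose t := (tperm p u * tperm (ordS p) v)%g.
  have Sp_val := val_ordS_even n2_even p_even.
  have Sp_odd : odd (ordS p) by rewrite Sp_val.
  have neq_par (i j : 'I_n.+2) : odd i != odd j -> (i == j) = false.
    by move=> par; apply: contraNF par => /eqP ->.
  have v_odd : odd v by rewrite /=.
  have t_on_even (i : 'I_n.+2) : ~~ odd i -> t i = tperm p u i.
    move=> i_even; rewrite permM [tperm (ordS p) v _]tpermD // neq_par //;
      by case: tpermP => [_|_|_ _];
        rewrite ?(negPf u_even) ?(negPf p_even) ?(negPf i_even) ?Sp_odd ?v_odd.
  have t_on_odd (i : 'I_n.+2) : odd i -> t i = tperm (ordS p) v i.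
    move=> i_odd; rewrite permM [tperm p u i]tpermD // neq_par // i_odd.
      by rewrite (negPf p_even).
    by rewrite (negPf u_even).
  rewrite [LHS](reindex_inj (mulgI t)) /=; apply: eq_big => s.
    rewrite !permM -![tperm _ _ (tperm _ _ _)]permM -/t.
    by rewrite t_on_even // t_on_odd // !tpermL.
  move=> _; apply: pf_term_pair_perm.
  - rewrite odd_permM !odd_tperm -Su.
    suff -> : (ordS p != ordS u) = (p != u) by rewrite addbb.
    by rewrite -!(inj_eq (@ord_inj _)) !val_ordS_even.
  - move=> i; have [i_odd|i_even] := boolP (odd i).
      by rewrite t_on_odd //; case: tpermP => [_|_|//]; rewrite ?Sp_odd ?v_odd.
    rewrite t_on_even //.
    by case: tpermP => [_|_|_ _]; rewrite ?(negPf u_even) ?(negPf p_even) ?(negPf i_even).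
  - move=> i i_even; rewrite (t_on_even i i_even) (t_on_odd (ordS i)) ?val_ordS_even //.
    have Sinj (a b : 'I_n.+2) : ~~ odd a -> ~~ odd b -> ordS a = ordS b -> a = b.
      move=> ae be /(congr1 (@nat_of_ord _)); rewrite !val_ordS_even // => -[]; exact: ord_inj.
    case: (tpermP p u i) => [->|->|ip iu]; rewrite ?tpermL // -Su ?tpermR //.
    by rewrite tpermD //; apply/eqP => /Sinj eqi; [apply: ip|apply: iu]; rewrite eqi.
have block (p : 'I_n.+2) : \sum_(s : 'S_n.+2 | s p == u) pf_term M s = S0.
  have [p_odd|p_even] := boolP (odd p); last first.
    rewrite -(even_block p p_even) [LHS](bigID (fun s : 'S__ => s (ordS p) == v)) /=.
    rewrite [X in _ + X]big1 ?addr0 // => s /andP[/eqP sp sSp].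
    by rewrite /pf_term (bigD1 p) //= sp Mu0 // mul0r mulr0.
  have p_gt0 : (0 < p)%N by case: (nat_of_ord p) p_odd.
  have pred_lt : (p.-1 < n.+2)%N by rewrite (leq_ltn_trans (leq_pred p)).
  pose i0 := Ordinal pred_lt; have i0_even : ~~ odd i0.
    by move: p_odd; rewrite /= -{1}(prednK p_gt0).
  have Si0 : ordS i0 = p by apply/ord_inj; rewrite val_ordS_even //= prednK.
  rewrite -(even_block i0 i0_even) Si0 [LHS](bigID (fun s : 'S__ => s i0 == v)) /=.
  rewrite [X in _ + X]big1 ?addr0 => [|s /andP[/eqP sp si0]].
    rewrite [LHS](reindex_inj (mulgI (tperm i0 p))) /=; apply: eq_big => s.
      by rewrite !permM tpermL tpermR.
    by move=> _; rewrite -Si0 pf_term_flip.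
  by rewrite /pf_term (bigD1 i0) //= Si0 sp Manti Mu0 // oppr0 mul0r mulr0.
have sumE : \sum_s pf_term M s = n.+2%:R * S0.
  rewrite (partition_big (fun s : 'S_n.+2 => (s^-1)%g u) xpredT) //=.
  rewrite (eq_bigr (fun=> S0)) ?sumr_const ?card_ord ?mulr_natl // => p _.
  rewrite -(block p); apply: eq_bigl => s.
  by apply/eqP/eqP => [<-|<-]; rewrite ?permKV ?permK.
(* The permutations fixing [u] and [v] are those of the first [n] indices. *)
have S0E : S0 = \sum_(s : 'S_n) pf_term N s.
  rewrite /S0.
  pose L (s : 'S_n) : 'S_n.+2 := lift_perm v v (lift_perm ord_max ord_max s).
  have Lu s : L s u = u by rewrite /L /u lift_perm_lift lift_perm_id.
  have Lv s : L s v = v by rewrite /L lift_perm_id.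
  have LL s i : L s (lift v (lift ord_max i)) = lift v (lift ord_max (s i)).
    by rewrite /L !lift_perm_lift.
  have Linj : injective L.
    move=> s1 s2 eqL; apply/permP => i.
    have := LL s1 i; rewrite eqL LL => /lift_inj /lift_inj ->//.
  pose Lim := (L @: [set: 'S_n])%SET.
  have LimE (s : 'S_n.+2) : ((s u == u) && (s v == v)) = (s \in Lim).
    apply/andP/imsetP => [[/eqP su /eqP sv]|[s' _ ->]]; last by rewrite Lu Lv.
    have ex i : exists j : 'I_n, s (lift v (lift ord_max i)) == lift v (lift ord_max j).
      case: (unliftP v (s (lift v (lift ord_max i)))) => [k|] ek; last first.
        have /(@perm_inj _ s)/eqP := etrans ek (esym sv).
        by rewrite eq_sym (negPf (neq_lift _ _)).
      rewrite ek; case: (unliftP ord_max k) => [k'|] ek'.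
        by exists k'; rewrite ek'.
      have /(@perm_inj _ s)/lift_inj/eqP : s (lift v (lift ord_max i)) = s u.
        by rewrite ek ek' su.
      by rewrite eq_sym (negPf (neq_lift _ _)).
    have finj : injective (fun i => xchoose (ex i)).
      move=> i j /= eqc; have := eqP (xchooseP (ex i)); rewrite eqc.
      by rewrite -(eqP (xchooseP (ex j))) => /(@perm_inj _ s) /lift_inj /lift_inj.
    exists (perm finj) => //; apply/permP => i.
    case: (unliftP v i) => [j|] ->; last by rewrite Lv sv.
    case: (unliftP ord_max j) => [k|] ->; last by rewrite -/u Lu su.
    by rewrite LL permE; apply/eqP; exact: (xchooseP (ex k)).
  rewrite (eq_bigl _ _ LimE) big_imset /=; last by move=> ? ? _ _; exact: Linj.
  apply: eq_big => [s|s _]; rewrite ?inE // /pf_term.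
  congr (_ * _); first by rewrite /L !odd_lift_perm !addbb.
  rewrite (bigD1 u) //= Su Lu Lv Muv1 mul1r.
  rewrite big_mkcond /= !big_ord_recr /=.
  have last_v : (widen_ord (leqnSn n.+1) ord_max : 'I_n.+2) = u.
    by apply/ord_inj; rewrite u_val.
  rewrite [X in _ * X = _]ifF ?mulr1; last by rewrite negbK (negPf n_even).
  rewrite [X in _ * X = _]ifF ?mulr1; last by rewrite last_v eqxx andbF.
  rewrite [RHS]big_mkcond; apply: eq_bigr => i _.
  have lift2 (k : 'I_n) : lift v (lift ord_max k) = k :> nat.
    by rewrite lift_max lift_max.
  have -> : widen_ord (leqnSn n.+1) (widen_ord (leqnSn n) i) =
            lift v (lift ord_max i) by apply/ord_inj; rewrite lift2.
  have -> : lift v (lift ord_max i) != u.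
    by rewrite /u (inj_eq lift_inj) eq_sym neq_lift.
  rewrite andbT; case: ifPn => // i_even; rewrite mxE LL; congr (M _ _).
  rewrite -LL; congr (L s _); apply/ord_inj.
  by rewrite lift2 !val_ordS_even ?lift2.
rewrite /pfaffian; have:= sumE; rewrite /pf_term => ->; rewrite S0E.
rewrite -/(pf_term N) mulrA; congr (_ * _).
have n2 : n = (n./2).*2 by rewrite -[LHS]odd_double_half (negPf n_even).
rewrite /= factS exprS.
have -> : n.+2%:R = 2 * (n./2).+1%:R :> R by rewrite -natrM; congr (_%:R); lia.
rewrite natrM; have F0 : (n./2)`!%:R != 0 :> R by rewrite pnatr_eq0 -lt0n fact_gt0.
have K0 : (n./2).+1%:R != 0 :> R by rewrite pnatr_eq0.
have P0 : 2 ^+ n./2 != 0 :> R by rewrite expf_neq0 ?pnatr_eq0.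
move: (n./2.+1%:R) K0 (_`!%:R) F0 (_ ^+ _) P0 => k k0 f f0 p p0.
by field; rewrite k0 f0 p0.
Qed.

End Pfaffians.

(** * Pfaffians of sequences of indices *)

Section SequencePfaffians.
Variables (R : realType) (I : Type) (x0 : I).
Implicit Types (K : I -> I -> R) (s u v : seq I).

(** The size [n] is a parameter instead of [size s], so that sequences whose
    sizes are only provably equal give matrices of the same type. *)
Definition pfseq n K s : R :=
  pfaffian (\matrix_(i < n, j < n) K (nth x0 s i) (nth x0 s j)).

Lemma pfseq_swap n K u v a b : (size u + (size v).+2)%N = n ->
  pfseq n K (u ++ a :: b :: v) = - pfseq n K (u ++ b :: a :: v).
Proof.
move=> sz; have lt1 : (size u < n)%N by rewrite -sz; lia.
have lt2 : ((size u).+1 < n)%N by rewrite -sz; lia.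
pose t := tperm (Ordinal lt1) (Ordinal lt2).
have t_odd : (-1) ^+ t = -1 :> R.
  rewrite odd_tperm -(inj_eq (@ord_inj _)) /=.
  by rewrite (_ : (size u != (size u).+1) = true) ?expr1 //; apply/eqP; lia.
rewrite -[RHS]mulN1r -t_odd -pfaffian_perm; congr pfaffian.
have nthE (i : 'I_n) : nth x0 (u ++ a :: b :: v) i = nth x0 (u ++ b :: a :: v) (t i).
  rewrite /t !nth_cat; case: tpermP => [->|->|/eqP i1 /eqP i2] /=.
  - by rewrite ltnn subnn ltnNge leqnSn /= subSn // subnn.
  - by rewrite ltnn subnn ltnNge leqnSn /= subSn // subnn.
  move: i1 i2; rewrite -!(inj_eq (@ord_inj _)) /= => /eqP i1 /eqP i2.
  case: ltnP => // ui; have -> : (i - size u = (i - size u).-2.+2)%N by lia.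
  by [].
by apply/matrixP => i j; rewrite !mxE !nthE.
Qed.

Lemma pfseq_linear n K (J : Type) (r : seq J) (f : J -> R) (d : J -> I) u v c :
    (size u + (size v).+1)%N = n -> ~~ odd n ->
    (forall e, K c e = \sum_(j <- r) f j * K (d j) e) ->
    (forall e, K e c = \sum_(j <- r) f j * K e (d j)) ->
  pfseq n K (u ++ c :: v) = \sum_(j <- r) f j * pfseq n K (u ++ d j :: v).
Proof.
move=> sz n_even Kl Kr; have lt1 : (size u < n)%N by rewrite -sz; lia.
have nth_k x : nth x0 (u ++ x :: v) (size u) = x by rewrite nth_cat ltnn subnn.
have nth_nk x y (i : 'I_n) : i != Ordinal lt1 ->
    nth x0 (u ++ x :: v) i = nth x0 (u ++ y :: v) i.
  rewrite -(inj_eq (@ord_inj _)) /= => /eqP iu; rewrite !nth_cat.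
  by case: ltnP => // ui; have -> : (i - size u = (i - size u).-1.+1)%N by lia.
apply: (@pfaffian_linear _ n (Ordinal lt1)) => //.
- by move=> j a b ak bk; rewrite !mxE (nth_nk (d j) c a) // (nth_nk (d j) c b).
- move=> a ak; rewrite mxE /= nth_k Kl; apply: eq_bigr => j _.
  by rewrite mxE /= nth_k (nth_nk (d j) c a).
- move=> a ak; rewrite mxE /= nth_k Kr; apply: eq_bigr => j _.
  by rewrite mxE /= nth_k (nth_nk (d j) c a).
Qed.

Lemma pfseq_border n K s a b :
    size s = n -> ~~ odd n -> (forall e e', K e e' = - K e' e) ->
    (forall e, e = a \/ List.In e s -> K a e = 0) -> K a b = 1 ->
  pfseq n.+2 K (s ++ [:: a; b]) = pfseq n K s.
Proof.
move=> sz n_even Kanti Ka0 Kab; rewrite /pfseq pfaffian_border //.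
- congr pfaffian; apply/matrixP => i j; rewrite !mxE !lift_max.
  by rewrite !nth_cat sz !ltn_ord.
- by move=> i j; rewrite !mxE Kanti.
- move=> i; rewrite -(inj_eq (@ord_inj _)) !mxE lift_max /= => iv.
  rewrite [X in K X _]nth_cat sz ltnn subnn; apply: Ka0; rewrite nth_cat sz.
  have := ltn_ord i; case: (ltnP i n) => [i_lt _|ni i_lt].
    right; have: (i < size s)%N by rewrite sz.
    elim: (s) (nat_of_ord i) => [|y s' IHs] [|k] //= ltk; first by left.
    by right; apply: IHs.
  by left; have -> : (i - n = 0)%N by move/eqP: iv; lia.
- rewrite !mxE lift_max /= !nth_cat sz ltnn subnn ltnNge leqnSn /=.
  by rewrite subSn // subnn.
Qed.

Lemma pfseq_eq (I' : Type) (y0 : I') (K' : I' -> I' -> R) n K s (s' : seq I') :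
    (forall i j : 'I_n, K (nth x0 s i) (nth x0 s j) =
                        K' (nth y0 s' i) (nth y0 s' j)) ->
  pfseq n K s = pfaffian (\matrix_(i < n, j < n) K' (nth y0 s' i) (nth y0 s' j)).
Proof. by move=> eqK; congr pfaffian; apply/matrixP => i j; rewrite !mxE. Qed.

End SequencePfaffians.

Section BilinearExtension.
Variables (R : realType) (J : Type).
Implicit Types (K : J -> J -> R) (v w : seq (R * J)).

Definition pure (j : J) : seq (R * J) := [:: (1, j)].

(** Rows indexed by formal linear combinations: expanding one row of a Pfaffian
    then replaces an index by other indices of the same type. *)
Definition bilin K v w : R := \sum_(p <- v) \sum_(r <- w) p.1 * r.1 * K p.2 r.2.

Lemma bilin_pure K a b : bilin K (pure a) (pure b) = K a b.
Proof. by rewrite /bilin !big_seq1 /= !mul1r. Qed.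

Lemma bilinl K v w : bilin K v w = \sum_(p <- v) p.1 * bilin K (pure p.2) w.
Proof.
apply: eq_bigr => p _; rewrite /bilin big_seq1 mulr_sumr.
by apply: eq_bigr => r _; rewrite /= mul1r mulrA.
Qed.

Lemma bilinr K v w : bilin K w v = \sum_(p <- v) p.1 * bilin K w (pure p.2).
Proof.
rewrite /bilin exchange_big; apply: eq_bigr => p _; rewrite mulr_sumr.
by apply: eq_bigr => r _; rewrite big_seq1 /= mulr1 mulrA [_ * p.1]mulrC.
Qed.

Lemma bilin_anti K : (forall a b, K a b = - K b a) ->
  forall v w, bilin K v w = - bilin K w v.
Proof.
move=> Kanti v w; rewrite /bilin exchange_big /= -sumrN; apply: eq_bigr => p _.
by rewrite -sumrN; apply: eq_bigr => r _; rewrite Kanti mulrN [r.1 * _]mulrC.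
Qed.

Lemma pfseq_combine n K (u w : seq (seq (R * J))) v :
    (size u + (size w).+1)%N = n -> ~~ odd n ->
  pfseq [::] n (bilin K) (u ++ v :: w) =
  \sum_(p <- v) p.1 * pfseq [::] n (bilin K) (u ++ pure p.2 :: w).
Proof.
move=> sz n_even; apply: pfseq_linear => // e; [exact: bilinl|exact: bilinr].
Qed.

End BilinearExtension.

(** * The two-row functions *)

Section TwoRow.
Variable R : realType.
Implicit Types (A B : seq R) (x : R) (u v : nat -> R).

(** Coefficients of the power series 1. *)
Definition e0 (n : nat) : R := (n == 0%N)%:R.

(** Multiplication of a power series by its variable. *)
Definition shift u (n : nat) : R := if n is m.+1 then u m else 0.

(** Multiplication of a power series by [(1 + x z) / (1 - x z)], which is how
    the [q_n] change when [x] is added to the alphabet. *)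
Definition addvar x u (n : nat) : R := \sum_(i < n.+1) qfactor x (n - i) * u i.

Lemma qfactor0 x : qfactor x 0 = 1.
Proof.
by rewrite /qfactor /cauchy_prod big_ord1 coefD coefZ coefX coef1 mulr0 addr0 mul1r.
Qed.

Lemma qfactorS x n : qfactor x n.+1 = 2 * x ^+ n.+1.
Proof.
rewrite /qfactor /cauchy_prod !big_ord_recl big1 => [|i _]; last first.
  by rewrite coefD coefZ coefX coef1 /= mulr0 addr0 mul0r.
rewrite !coefD !coefZ !coefX !coef1 /= /bump /= subn0 subSS subn0 exprS; ring.
Qed.

Lemma qfun_cons x A n : qfun n (x :: A) = addvar x (fun i => qfun i A) n.
Proof.
rewrite {1}/qfun /= /cauchy_prod (reindex_inj rev_ord_inj) /=.
by apply: eq_bigr => i _; rewrite subSS subKn // -ltnS.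
Qed.

Lemma qfun_nil n : qfun n [::] = e0 n. Proof. by []. Qed.

Lemma addvar0 x u : addvar x u 0 = u 0%N.
Proof. by rewrite /addvar big_ord1 qfactor0 mul1r. Qed.

Lemma qfun0 A : qfun 0 A = 1.
Proof. by elim: A => [|x A IHA] //; rewrite qfun_cons addvar0. Qed.

Lemma eq_addvar x u v : u =1 v -> addvar x u =1 addvar x v.
Proof. by move=> eq_uv n; apply: eq_bigr => i _; rewrite eq_uv. Qed.

Lemma addvarD x u v n :
  addvar x (fun i => u i + v i) n = addvar x u n + addvar x v n.
Proof. by rewrite -big_split; apply: eq_bigr => i _ /=; rewrite mulrDr. Qed.

Lemma addvarZ x c u n : addvar x (fun i => c * u i) n = c * addvar x u n.
Proof. by rewrite big_distrr; apply: eq_bigr => i _ /=; rewrite mulrCA. Qed.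

Lemma addvarN x u n : addvar x (fun i => - u i) n = - addvar x u n.
Proof.
rewrite -[RHS]mulN1r -addvarZ; apply: eq_addvar => i.
by rewrite mulN1r.
Qed.

Lemma addvarZr x c u n : addvar x (fun i => u i * c) n = addvar x u n * c.
Proof. by rewrite [RHS]mulrC -addvarZ; apply: eq_addvar => i; rewrite mulrC. Qed.

Lemma addvar_cst0 x n : addvar x (fun=> 0) n = 0.
Proof. by rewrite /addvar big1 // => i _; rewrite mulr0. Qed.

Lemma addvar_shift x u n : addvar x (shift u) n = shift (addvar x u) n.
Proof.
case: n => [|n] /=; first by rewrite addvar0.
rewrite /addvar big_ord_recl /= mulr0 add0r.
by apply: eq_bigr => i _; rewrite /bump add1n subSS.
Qed.

Lemma addvar_e0 x n : addvar x e0 n = qfactor x n.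
Proof.
rewrite /addvar big_ord_recl /e0 /= mulr1 subn0 big1 ?addr0 // => i _.
by rewrite mulr0.
Qed.

(** Coefficients of [Q(z, w) = (q(z) q(w) - 1) (z - w) / (z + w)]. The
    correction at [(0, 0)] is what makes this array antisymmetric. *)
Definition Qcoef A a b : R := Q2 a b A - e0 a * e0 b.

Lemma Qcoef_r0 A a : Qcoef A a 0 = qfun a A - e0 a.
Proof. by rewrite /Qcoef /Q2 big_geq // mulr0 addr0 qfun0 /e0 !mulr1. Qed.

Lemma Qcoef_rec A a b :
  Qcoef A a b.+1 = - Qcoef A a.+1 b + qfun a A * qfun b.+1 A - qfun a.+1 A * qfun b A.
Proof.
rewrite /Qcoef /Q2 /e0 /= !mulr0 mul0r.
rewrite (@big_ltn _ _ _ 1 b.+2) // big_add1 /=.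
rewrite (eq_big_nat _ _ (F2 := fun i =>
  - ((-1) ^+ i * qfun (a.+1 + i) A * qfun (b - i) A))).
  by rewrite sumrN expr1 subSS subn0 addn1; ring.
by move=> i _; rewrite exprS subSS addSnnS; ring.
Qed.

(** The coefficients of [(z + w) Q(z, w) = (z - w) (q(z) q(w) - 1)]. *)
Definition two_row_eq (G : nat -> nat -> R) (q : nat -> R) := forall a b,
  shift (G^~ b) a + shift (G a) b =
  shift q a * q b - q a * shift q b - shift e0 a * e0 b + e0 a * shift e0 b.

(** [(z - w) (q(z) q(w) - 1)] is antisymmetric and [z + w] is symmetric and
    not a zero divisor. *)
Lemma two_row_anti G q : two_row_eq G q -> forall a b, G a b = - G b a.
Proof.
move=> HG a b; apply/eqP; rewrite -addr_eq0; apply/eqP.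
elim: b a => [|b IHb] a.
  have := HG a.+1 0%N; have := HG 0%N a.+1; rewrite /= !addr0 !add0r => -> ->.
  by ring.
have := HG a.+1 b.+1; have := HG b.+1 a.+1; rewrite /= => h1 h2.
by have := IHb a.+1; move: h1 h2; rewrite /e0 /=; lra.
Qed.

(** With [F(z) = (1 + x z) / (1 - x z)], adding [x] turns [Q(z, w)] into
    [F(z) F(w) Q(z, w) + F(z) - F(w)]. This rests on the addition formula
    [(z + w) (F(z) - F(w)) = (z - w) (F(z) F(w) - 1)], the one of the hyperbolic
    tangent. *)
Lemma addvar_two_row x G q : q 0%N = 1 -> two_row_eq G q ->
  two_row_eq (fun a b => addvar x (fun i => addvar x (G i) b) a
                         + qfactor x a * e0 b - e0 a * qfactor x b) (addvar x q).
Proof.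
move=> q0 HG a b.
set F := fun a b => addvar x (fun i => addvar x (G i) b) a.
have FE : shift (F^~ b) a + shift (F a) b =
    addvar x (fun i => addvar x (fun j => shift (G^~ j) i + shift (G i) j) b) a.
  have -> : shift (F^~ b) a = addvar x (fun i => addvar x (fun j => shift (G^~ j) i) b) a.
    rewrite -addvar_shift; apply: eq_addvar => -[|i] //=.
    by rewrite addvar_cst0.
  have -> : shift (F a) b = addvar x (fun i => addvar x (fun j => shift (G i) j) b) a.
    rewrite -(@eq_addvar x (fun i => shift (addvar x (G i)) b)).
      by case: b => [|b] //=; rewrite addvar_cst0.
    by move=> i; rewrite addvar_shift.
  by rewrite -addvarD; apply: eq_addvar => i; rewrite -addvarD.
have {}FE : shift (F^~ b) a + shift (F a) b =
    shift (addvar x q) a * addvar x q b - addvar x q a * shift (addvar x q) b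
    - shift (qfactor x) a * qfactor x b + qfactor x a * shift (qfactor x) b.
  have shE c : shift (qfactor x) c = addvar x (shift e0) c.
    by rewrite addvar_shift; case: c => //= c; rewrite addvar_e0.
  rewrite FE !shE -!addvar_e0 -!addvar_shift.
  rewrite -(@eq_addvar x (fun i => shift q i * addvar x q b
      + - (q i * addvar x (shift q) b) + - (shift e0 i * addvar x e0 b)
      + e0 i * addvar x (shift e0) b)).
    by rewrite !addvarD !addvarN !addvarZr.
  move=> i; rewrite [RHS](@eq_addvar x _ (fun j => shift q i * q j
      + - (q i * shift q j) + - (shift e0 i * e0 j)
      + e0 i * shift e0 j)); last by move=> j; exact: HG.
  by rewrite !addvarD !addvarN !addvarZ.
have -> : shift (fun a => F a b + qfactor x a * e0 b - e0 a * qfactor x b) a =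
    shift (F^~ b) a + shift (qfactor x) a * e0 b - shift e0 a * qfactor x b.
  by case: (a) => //=; rewrite !mul0r !addr0 subr0.
have -> : shift (fun b => F a b + qfactor x a * e0 b - e0 a * qfactor x b) b =
    shift (F a) b + qfactor x a * shift e0 b - e0 a * shift (qfactor x) b.
  by case: (b) => //=; rewrite !mulr0 !addr0 subr0.
(* The addition formula, coefficient by coefficient. *)
have tanh_add : shift (qfactor x) a * e0 b - shift e0 a * qfactor x b
    + qfactor x a * shift e0 b - e0 a * shift (qfactor x) b =
    shift (qfactor x) a * qfactor x b - qfactor x a * shift (qfactor x) b
    - shift e0 a * e0 b + e0 a * shift e0 b.
  by case: a {FE} => [|[|a]]; case: b => [|[|b]];
    rewrite /= ?qfactor0 ?qfactorS /e0 /= ?exprS ?expr0; ring.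
move: FE tanh_add; lra.
Qed.

(** The rows with positive first index of the equation already determine the
    array; these hold for [Qcoef A] by its definition. *)
Lemma Qcoef_unique A G : two_row_eq G (fun i => qfun i A) -> forall a b, G a b = Qcoef A a b.
Proof.
move=> HG a b; elim: b a => [|b IHb] a.
  by have := HG a.+1 0%N; rewrite /= addr0 qfun0 /e0 /= Qcoef_r0 => ->; ring.
rewrite Qcoef_rec -IHb.
have /= := HG a.+1 b.+1; rewrite /e0 /=; lra.
Qed.

Lemma Qcoef_nil a b : Qcoef [::] a b = 0.
Proof.
elim: b a => [|b IHb] a; first by rewrite Qcoef_r0 qfun_nil subrr.
by rewrite Qcoef_rec IHb !qfun_nil /e0 /=; ring.
Qed.

Lemma two_row_cons x B : two_row_eq (Qcoef B) (fun i => qfun i B) ->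
  two_row_eq (fun a b => addvar x (fun i => addvar x (Qcoef B i) b) a
                         + qfactor x a * e0 b - e0 a * qfactor x b)
             (fun i => qfun i (x :: B)).
Proof.
move=> HB c d; rewrite (addvar_two_row x (qfun0 B) HB) !qfun_cons.
congr (_ * _ - _ * _ - _ + _).
  by case: c => // k; exact/esym/qfun_cons.
by case: d => // k; exact/esym/qfun_cons.
Qed.

(** Contrary to the rows used above, the row of index 0 says that
    [q(z) q(-z) = 1]; it is obtained by adding the variables one by one. *)
Lemma Qcoef_two_row A : two_row_eq (Qcoef A) (fun i => qfun i A).
Proof.
elim: A => [|x B IHB] a b.
  have -> : shift ((Qcoef [::])^~ b) a = 0 by case: a => //= a; exact: Qcoef_nil.
  have -> : shift (Qcoef [::] a) b = 0 by case: b => //= b; exact: Qcoef_nil.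
  have -> c : shift (fun i => qfun i [::]) c = shift e0 c by case: c.
  by rewrite !qfun_nil; ring.
have HB := two_row_cons x IHB; have E := Qcoef_unique HB.
rewrite -(HB a b); congr (_ + _).
  by case: a => //= a; rewrite E.
by case: b => //= b; rewrite E.
Qed.

Lemma Qcoef_anti A a b : Qcoef A a b = - Qcoef A b a.
Proof. exact: two_row_anti (Qcoef_two_row A) _ _. Qed.

(** At positive indices the term [F(z) - F(w)] disappears, so adding a variable
    acts on rows and columns separately. *)
Lemma Qcoef_cons x B a b : (0 < a)%N -> (0 < b)%N ->
  Qcoef (x :: B) a b = addvar x (fun i => addvar x (Qcoef B i) b) a.
Proof.
rewrite -(Qcoef_unique (two_row_cons x (@Qcoef_two_row B))).
by case: a b => [|a] [|b] //= _ _; rewrite /e0 /= mulr0 mul0r addr0 subr0.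
Qed.

End TwoRow.

(** * Transfer weights *)

Section StrictSequences.

Fixpoint strict_seqs (k : nat) : seq (seq nat) :=
  if k is k'.+1 then strict_seqs k' ++ [seq k :: s | s <- strict_seqs k']
  else [:: [::]].

Lemma mem_strict_seqs k s :
  (s \in strict_seqs k) =
  [&& sorted gtn s, 0%N \notin s & all (fun i => i <= k)%N s].
Proof.
elim: k s => [|k IHk] s /=.
  rewrite mem_seq1; case: s => [|[|a] s] //=; rewrite ?inE ?eqxx ?andbF //.
rewrite mem_cat IHk; apply/orP/and3P => [[/and3P[ss s0 sk]|/mapP[t]]|[ss s0 sk]].
- by split=> //; apply: sub_all sk => i /leqW.
- rewrite IHk => /and3P[ts t0 tk] ->; split => //=.
  + rewrite path_sortedE ?ts ?andbT //; last by move=> ? ? ? /= h1 h2; apply: ltn_trans h2 h1.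
  + by rewrite leqnn; apply: sub_all tk => i /leqW.
case: s ss s0 sk => [|a s] /=; first by left.
rewrite path_sortedE; last by move=> ? ? ? /= h1 h2; apply: ltn_trans h2 h1.
rewrite inE negb_or => /andP[sa ss] /andP[a0 s0] /andP[ak _].
have [eak|ak1] := eqVneq a k.+1; [right|left].
  rewrite eak in sa *; apply/mapP; exists s => //; rewrite IHk ss s0 /=.
  by apply: sub_all sa.
rewrite a0 s0 sa ss /=.
have {ak1} ak1 : (a <= k)%N by rewrite -ltnS ltn_neqAle ak1.
by rewrite ak1 /=; apply: sub_all sa => i /= /ltnW ia; apply: leq_trans ia ak1.
Qed.

Lemma notin_strict_seqs k j s : s \in strict_seqs k -> (k < j)%N -> j \notin s.
Proof.
rewrite mem_strict_seqs => /and3P[_ _ /allP sk] kj.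
by apply/negP => /sk; rewrite leqNgt kj.
Qed.

Lemma uniq_strict_seqs k : uniq (strict_seqs k).
Proof.
elim: k => //= k IHk; rewrite cat_uniq IHk map_inj_uniq ?IHk ?andbT //; last by move=> s t [].
apply/hasPn => _ /mapP[s _ ->]; apply/negP => /notin_strict_seqs/(_ (leqnn _)).
by rewrite inE eqxx.
Qed.

Lemma big_strict_seqs (V : nmodType) k (F : seq nat -> V) :
  \sum_(s <- strict_seqs k.+1) F s =
  \sum_(s <- strict_seqs k) F s + \sum_(s <- strict_seqs k) F (k.+1 :: s).
Proof. by rewrite big_cat big_map. Qed.

Lemma strict_seqsS k la : la \in strict_seqs k.+1 ->
  la \in strict_seqs k \/ exists2 la', la' \in strict_seqs k & la = k.+1 :: la'.
Proof. by rewrite /= mem_cat => /orP[lak|/mapP]; [left|right]. Qed.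

End StrictSequences.

Section TransferWeights.
Variable S : comNzRingType.

(** The pair [(la, mu)] is read from the largest integer down to 1, [b] and [m]
    telling whether the current integer is a part of [la], of [mu]. The state
    is true when one more part of [la] than of [mu] has been met. Since the
    difference must stay 0 or 1, the accepted pairs are the interlacing ones
    [la_1 >= mu_1 >= la_2 >= mu_2 >= ...]. *)
Definition next_state (s b m : bool) : bool := if b == m then s else b.

(** Each column in state true contributes [x], entering this state costs [o]
    and leaving it costs [c]; forbidden moves have weight 0. With [o = 2] and
    [c = 1] the product is [Q_{la/mu}(x)], with [o = 1] and [c = 2] it is
    [P_{la/mu}(x)]. *)
Definition site_weight (o c x : S) (s b m : bool) : S :=
  if b == m then x ^+ s
  else if s then (if b then 0 else c) else (if b then o * x else 0).

Fixpoint transfer (o c x : S) (k : nat) (s : bool) (la mu : seq nat) : S :=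
  if k is k'.+1 then
    site_weight o c x s (k \in la) (k \in mu) *
    transfer o c x k' (next_state s (k \in la) (k \in mu)) la mu
  else 1.

Lemma transferS o c x k s la mu : transfer o c x k.+1 s la mu =
  site_weight o c x s (k.+1 \in la) (k.+1 \in mu) *
  transfer o c x k (next_state s (k.+1 \in la) (k.+1 \in mu)) la mu.
Proof. by []. Qed.

Lemma transfer_eq o c x k s la la' mu mu' :
    (forall j, (0 < j <= k)%N -> (j \in la) = (j \in la')) ->
    (forall j, (0 < j <= k)%N -> (j \in mu) = (j \in mu')) ->
  transfer o c x k s la mu = transfer o c x k s la' mu'.
Proof.
elim: k s => //= k IHk s eql eqm; rewrite eql ?eqm ?leqnn // IHk //.
  by move=> j /andP[j0 jk]; rewrite eql // j0 leqW.
by move=> j /andP[j0 jk]; rewrite eqm // j0 leqW.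
Qed.

Lemma transfer_consl o c x k j s la mu : (k < j)%N ->
  transfer o c x k s (j :: la) mu = transfer o c x k s la mu.
Proof.
by move=> kj; apply: transfer_eq => // i /andP[_ ik]; rewrite inE; case: eqP => //; lia.
Qed.

Lemma transfer_consr o c x k j s la mu : (k < j)%N ->
  transfer o c x k s la (j :: mu) = transfer o c x k s la mu.
Proof.
by move=> kj; apply: transfer_eq => // i /andP[_ ik]; rewrite inE; case: eqP => //; lia.
Qed.

Lemma transferS00 o c x k s la mu : la \in strict_seqs k -> mu \in strict_seqs k ->
  transfer o c x k.+1 s la mu = x ^+ s * transfer o c x k s la mu.
Proof.
by move=> lak muk; rewrite /= !(negPf (notin_strict_seqs _ (leqnn _))) /site_weight.
Qed.

Lemma transferS11 o c x k s la mu :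
  transfer o c x k.+1 s (k.+1 :: la) (k.+1 :: mu) = x ^+ s * transfer o c x k s la mu.
Proof. by rewrite /= !mem_head /site_weight /= transfer_consl // transfer_consr. Qed.

Lemma transferS10 o c x k s la mu : mu \in strict_seqs k ->
  transfer o c x k.+1 s (k.+1 :: la) mu =
  (if s then 0 else o * x) * transfer o c x k true la mu.
Proof.
move=> muk; rewrite /= mem_head (negPf (notin_strict_seqs _ (leqnn _))) //.
by rewrite /site_weight /= transfer_consl.
Qed.

Lemma transferS01 o c x k s la mu : la \in strict_seqs k ->
  transfer o c x k.+1 s la (k.+1 :: mu) =
  (if s then c else 0) * transfer o c x k false la mu.
Proof.
move=> lak; rewrite /= mem_head (negPf (notin_strict_seqs _ (leqnn _))) //.
by rewrite /site_weight /= transfer_consr.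
Qed.

End TransferWeights.
Arguments transfer : simpl never.

(** * Straightening *)

Section Straightening.
Variable R : realType.
Implicit Types (x : R) (A : seq nat -> R) (la mu : seq nat).

(** The expansion of a multilinear function of the rows when a variable [x] is
    added: every part of [la] is lowered independently of the others. *)
Fixpoint lower_all x la A : R :=
  if la is l :: la' then
    \sum_(a < l.+1) qfactor x (l - a) * lower_all x la' (fun nu => A (nat_of_ord a :: nu))
  else A [::].

Definition alternating (n : nat) A := forall u v a b,
  (size u + (size v).+2)%N = n -> A (u ++ a :: b :: v) = - A (u ++ b :: a :: v).

Lemma alternating_cons n A a : alternating n.+1 A -> alternating n (fun nu => A (a :: nu)).
Proof. by move=> altA u v b c sz; rewrite -!cat_cons altA //= addSn sz. Qed.

Lemma eq_lower_all x la A A' : (forall nu, size nu = size la -> A nu = A' nu) ->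
  lower_all x la A = lower_all x la A'.
Proof.
elim: la A A' => [|l la IHla] A A' eqA /=; first exact: eqA.
apply: eq_bigr => a _; congr (_ * _); apply: IHla => nu sz.
by apply: eqA; rewrite /= sz.
Qed.

Lemma lower_allN x la A : lower_all x la (fun nu => - A nu) = - lower_all x la A.
Proof.
elim: la A => //= l la IHla A; rewrite -sumrN; apply: eq_bigr => a _.
by rewrite IHla mulrN.
Qed.

Lemma antisym_sum0 n (c : nat -> R) (D : nat -> nat -> R) :
    (forall a b, D a b = - D b a) ->
  \sum_(a < n) \sum_(b < n) c a * c b * D a b = 0.
Proof.
move=> Danti; set S := (X in X = 0).
have : S = - S.
  rewrite {1}/S exchange_big /= /S -sumrN; apply: eq_bigr => a _.
  by rewrite -sumrN; apply: eq_bigr => b _; rewrite Danti; ring.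
lra.
Qed.

(** On an alternating function, [lower_all] keeps only the interlacing terms.
    The second formula describes state true at level [k]: a part
    of [la] larger than [k] is still to be lowered to some [a <= k]. When [k] is
    itself a part of [la], the two parts now being lowered have proportional
    weights, up to a term where the second one stays in place; by antisymmetry
    only this term survives, and it is the move that stays in state true.
    A part lowered to 0 is absent from [mu], hence the padding by [nseq]. *)
Lemma lower_all_straighten k x la : la \in strict_seqs k ->
  (forall A, alternating (size la) A ->
    lower_all x la A = \sum_(mu <- strict_seqs k)
      transfer 2 1 x k false la mu * A (mu ++ nseq (size la - size mu) 0%N)) /\
  (forall A, alternating (size la).+1 A ->
    \sum_(a < k.+1) x ^+ (k - a) * lower_all x la (fun nu => A (nat_of_ord a :: nu)) =
    \sum_(mu <- strict_seqs k)
      transfer 2 1 x k true la mu * A (mu ++ nseq ((size la).+1 - size mu) 0%N)).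
Proof.
elim: k la => [|k IHk] la.
  rewrite mem_seq1 => /eqP ->; split=> A _.
    by rewrite big_seq1 /= mul1r.
  by rewrite big_ord1 big_seq1 /= subnn expr0.
case/strict_seqsS => [lak|[la' lak ->]].
  have [IH0 IH1] := IHk la lak; split=> A altA; rewrite big_strict_seqs.
    rewrite [X in _ = _ + X]big1_seq ?addr0 => [|mu _]; last first.
      by rewrite transferS01 // !mul0r.
    rewrite IH0 // !big_seq; apply: eq_bigr => mu muk.
    by rewrite transferS00 // mul1r.
  rewrite big_ord_recr /= subnn expr0 mul1r addrC [RHS]addrC.
  congr (_ + _).
    rewrite IH0; last exact: alternating_cons.
    by apply: eq_bigr => mu _; rewrite transferS01 // mul1r /= subSS.
  rewrite [RHS]big_seq (eq_bigr (fun mu => x * (transfer 2 1 x k true la mu *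
     A (mu ++ nseq ((size la).+1 - size mu) 0%N)))) => [|mu muk]; last first.
    by rewrite transferS00 // expr1 mulrA.
  rewrite -big_seq -big_distrr /= -IH1 // big_distrr /=; apply: eq_bigr => a _.
  by rewrite subSn ?exprS ?mulrA // -ltnS.
have [IH0 IH1] := IHk la' lak; split=> A altA; rewrite big_strict_seqs.
  rewrite /= big_ord_recr /= subnn qfactor0 mul1r addrC [RHS]addrC; congr (_ + _).
    rewrite IH0; last exact: alternating_cons.
    by apply: eq_bigr => mu _; rewrite transferS11 mul1r subSS.
  rewrite [RHS]big_seq (eq_bigr (fun mu => 2 * x * (transfer 2 1 x k true la' mu *
     A (mu ++ nseq ((size la').+1 - size mu) 0%N)))) => [|mu muk]; last first.
    by rewrite transferS10 // mulrA.
  rewrite -big_seq -big_distrr /= -IH1 // big_distrr /=; apply: eq_bigr => a _.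
  by rewrite subSn -1?ltnS // qfactorS exprS; ring.
pose D a b := lower_all x la' (fun nu => A [:: a, b & nu]).
have Danti a b : D a b = - D b a.
  rewrite /D -lower_allN; apply: eq_lower_all => nu sz.
  by rewrite (altA [::] nu) //= sz.
pose c a := x ^+ (k.+1 - a).
have Dkk : D k.+1 k.+1 = 0 by have := Danti k.+1 k.+1; lra.
transitivity (x * \sum_(a < k.+1) x ^+ (k - a) * D k.+1 a).
  (* [qfactor x n] is [2 * x ^+ n], less 1 for [n = 0]. *)
  transitivity (2 * (\sum_(a < k.+2) \sum_(b < k.+2) c a * c b * D a b)
                + \sum_(a < k.+2) c a * D k.+1 a).
    rewrite big_distrr /= -big_split /=; apply: eq_bigr => a _.
    rewrite [X in _ = 2 * X + _]big_ord_recr [X in _ * X = _]big_ord_recr /=.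
    rewrite -/(D a k.+1) subnn qfactor0 mul1r [c k.+1]/c subnn expr0 mulr1.
    rewrite (Danti a k.+1) -/(c a).
    have -> : \sum_(i < k.+1) c a * c i * D a i =
              c a * \sum_(i < k.+1) c i * D a i.
      by rewrite big_distrr; apply: eq_bigr => i _ /=; rewrite mulrA.
    have -> : \sum_(i < k.+1) qfactor x (k.+1 - i) * D a i =
              2 * \sum_(i < k.+1) c i * D a i.
      rewrite big_distrr; apply: eq_bigr => i _ /=.
      by rewrite /c subSn -1?ltnS // qfactorS mulrA.
    by rewrite mulrDr; ring.
  rewrite (antisym_sum0 _ _ Danti) mulr0 add0r big_ord_recr /= Dkk mulr0 addr0.
  rewrite big_distrr; apply: eq_bigr => a _ /=.
  by rewrite /c subSn -1?ltnS // exprS mulrA.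
rewrite [X in _ = X + _]big_seq [X in _ = X + _]big1 ?add0r => [|mu muk]; last first.
  by rewrite transferS10 // !mul0r.
rewrite [RHS](_ : _ = \sum_(mu <- strict_seqs k) x * (transfer 2 1 x k true la' mu *
   A (k.+1 :: mu ++ nseq ((size la').+1 - size mu) 0%N))).
  by rewrite -big_distrr /= -(IH1 (fun nu => A (k.+1 :: nu))) //; exact: alternating_cons.
by apply: eq_bigr => mu _; rewrite transferS11 expr1 mulrA.
Qed.

Lemma transfer_size (S : comNzRingType) (o c y : S) k s la mu :
    la \in strict_seqs k -> mu \in strict_seqs k ->
    transfer o c y k s la mu != 0 ->
  (size mu <= size la + s <= (size mu).+1)%N.
Proof.
elim: k s la mu => [|k IHk] s la mu.
  by rewrite !mem_seq1 => /eqP -> /eqP ->; case: s.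
case/strict_seqsS => [lak|[la' lak ->]]; case/strict_seqsS => [muk|[mu' muk ->]].
- rewrite transferS00 // => nz; apply: IHk => //.
  by apply: contraNneq nz => ->; rewrite mulr0.
- rewrite transferS01 // => nz; have /(IHk false): transfer o c y k false la mu' != 0.
    by apply: contraNneq nz => ->; rewrite mulr0.
  by case: s nz => [_|]; rewrite ?mul0r ?eqxx //= => /(_ lak muk); lia.
- rewrite transferS10 // => nz; have /(IHk true): transfer o c y k true la' mu != 0.
    by apply: contraNneq nz => ->; rewrite mulr0.
  by case: s nz => [|_]; rewrite ?mul0r ?eqxx //= => /(_ lak muk); lia.
- rewrite transferS11 => nz; have /(IHk s) : transfer o c y k s la' mu' != 0.
    by apply: contraNneq nz => ->; rewrite mulr0.
  by rewrite /= => /(_ lak muk); lia.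
Qed.

End Straightening.

(** * The branching rule *)

Arguments qfun : simpl never.

Section Branching.
Variable R : realType.
Implicit Types (x : R) (A B : seq R) (la mu : seq nat).

(** The index [None] is the zero part appended to partitions of odd length. It
    differs from [Some 0], to which a part may be lowered: the entry of these
    two indices is [q_0 = 1]. *)
Definition Qker A (a b : option nat) : R :=
  match a, b with
  | Some i, Some j => Qcoef A i j
  | Some i, None => qfun i A
  | None, Some j => - qfun j A
  | None, None => 0
  end.

Lemma Qker_anti A a b : Qker A a b = - Qker A b a.
Proof. by case: a b => [i|] [j|] /=; rewrite ?opprK ?oppr0 // Qcoef_anti. Qed.

Definition part (i : nat) : seq (R * option nat) := pure R (Some i).
Definition infty : seq (R * option nat) := pure R None.

(** [Q_nu] for an arbitrary sequence [nu] of parts, with [o] appended zeros. *)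
Definition Qpf A n nu (o : nat) : R :=
  pfseq [::] n (bilin (Qker A)) ([seq part i | i <- nu] ++ nseq o infty).

Definition Qseq la A : R := Qpf A (size la + odd (size la)) la (odd (size la)).

Lemma nth_parts (f : nat -> seq (R * option nat)) la o i :
  (i < size la + o)%N ->
  nth [::] ([seq f i | i <- la] ++ nseq o infty) i =
  if (i < size la)%N then f (nth 0%N la i) else infty.
Proof.
move=> i_lt; rewrite nth_cat size_map; case: ltnP => il.
  by rewrite (nth_map 0%N).
by rewrite nth_nseq ifT //; lia.
Qed.

Lemma nth_pos la i : 0%N \notin la -> (i < size la)%N -> (0 < nth 0%N la i)%N.
Proof. by move=> la0 il; rewrite lt0n; apply: contraNneq la0 => <-; exact: mem_nth. Qed.

Lemma Qcoef_Q2 A a b : (0 < a)%N -> Qcoef A a b = Q2 a b A.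
Proof. by case: a => // a _; rewrite /Qcoef /e0 mul0r subr0. Qed.

Lemma Qfun_Qseq (la : strict_partition) A : Qfun la A = Qseq la A.
Proof.
case: la => la la_strict; have /andP[_ la0] := la_strict.
rewrite /Qfun /Qseq /Qpf /pfseq /=; congr pfaffian.
apply/matrixP => i j; rewrite !mxE /=.
have upper (a b : 'I_(size la + odd (size la))) : (a < b)%N ->
    Q2 (nth 0%N la a) (nth 0%N la b) A =
    bilin (Qker A) (nth [::] ([seq part i | i <- la] ++ nseq (odd (size la)) infty) a)
                   (nth [::] ([seq part i | i <- la] ++ nseq (odd (size la)) infty) b).
  move=> ab; rewrite !nth_parts //.
  have a_lt : (a < size la)%N by have := ltn_ord b; have := leq_b1 (odd (size la)); lia.
  rewrite a_lt; case: ltnP => bl; rewrite bilin_pure /= -Qcoef_Q2 ?nth_pos //.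
  rewrite (nth_default _ bl) Qcoef_r0 /e0; have := nth_pos la0 a_lt.
  by case: (nth 0%N la a) => // k _; rewrite subr0.
case: ltngtP => [ij|ji|ij]; first exact: upper.
- by rewrite upper // -(bilin_anti (Qker_anti A)).
set P := _ ++ _; have := bilin_anti (Qker_anti A) (nth [::] P i) (nth [::] P i).
by rewrite -ij; lra.
Qed.

(** The row of [a] for the alphabet [x :: B], in terms of the rows for [B]. *)
Definition added_part x (a : nat) : seq (R * option nat) :=
  [seq (qfactor x (a - i), Some i) | i <- iota 0 a.+1].

Lemma big_added_part x a (F : seq (R * option nat) -> R) :
  \sum_(p <- added_part x a) p.1 * F (pure R p.2) = addvar x (fun i => F (part i)) a.
Proof.
by rewrite big_map -[iota _ _]/(index_iota 0 a.+1) big_mkord.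
Qed.

Lemma Qpf_cons x B n la o : 0%N \notin la -> n = (size la + o)%N ->
  Qpf (x :: B) n la o =
  pfseq [::] n (bilin (Qker B)) ([seq added_part x a | a <- la] ++ nseq o infty).
Proof.
move=> la0 ->; rewrite /Qpf; apply: pfseq_eq => i j.
rewrite !nth_parts //.
case: ltnP => [il|_]; case: ltnP => [jl|_]; rewrite ?bilin_pure //=.
- rewrite Qcoef_cons ?nth_pos // bilinl (big_added_part x _ (fun v => bilin _ v _)).
  apply: eq_addvar => a; rewrite bilinr (big_added_part x _ (fun v => bilin _ _ v)).
  by apply: eq_addvar => b; rewrite bilin_pure.
- rewrite qfun_cons bilinl (big_added_part x _ (fun v => bilin _ v _)).
  by apply: eq_addvar => a; rewrite bilin_pure.
- rewrite qfun_cons -addvarN bilinr (big_added_part x _ (fun v => bilin _ _ v)).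
  by apply: eq_addvar => a; rewrite bilin_pure.
Qed.

Lemma pfseq_lower_all x B n (u w : seq (seq (R * option nat))) la :
    (size u + size la + size w)%N = n -> ~~ odd n ->
  pfseq [::] n (bilin (Qker B)) (u ++ [seq added_part x a | a <- la] ++ w) =
  lower_all x la (fun nu =>
    pfseq [::] n (bilin (Qker B)) (u ++ [seq part a | a <- nu] ++ w)).
Proof.
move=> sz n_even; elim: la u sz => [|l la IHla] u sz //=.
rewrite pfseq_combine //; last by rewrite size_cat size_map -sz /=; lia.
rewrite (big_added_part x _ (fun v => pfseq _ _ _ (u ++ v :: _))).
apply: eq_bigr => a _; congr (_ * _).
rewrite -cat_rcons IHla; last by rewrite size_rcons -sz /=; lia.
by apply: eq_lower_all => nu _; rewrite cat_rcons.
Qed.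

(** A part lowered to 0 can be dropped. If it restores an even length, it plays
    the part of the appended zero. Otherwise the zero part and the appended
    one are both present; subtracting the second from the first leaves a row
    whose only nonzero entry is the one between them. *)
Lemma Qpf_zero B mu : 0%N \notin mu ->
  Qpf B (size mu + 1 + ~~ odd (size mu)) (mu ++ [:: 0%N]) (~~ odd (size mu)) = Qseq mu B.
Proof.
move=> mu0; have anti := bilin_anti (Qker_anti B).
have diag v : bilin (Qker B) v v = 0 by have := anti v v; lra.
have part0 i : (0 < i)%N -> Qcoef B i 0 = qfun i B.
  by case: i => // i _; rewrite Qcoef_r0 /e0 subr0.
have [mu_odd|mu_even] /= := boolP (odd (size mu)).
  rewrite /Qseq mu_odd addn0 /Qpf cats0 map_cat /=; apply: pfseq_eq => i j.
  have i_lt : (i < size mu + 1)%N by [].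
  have nthE (f : seq (R * option nat)) (k : 'I_(size mu + 1)) :
      nth [::] ([seq part i | i <- mu] ++ [:: f]) k =
      if (k < size mu)%N then part (nth 0%N mu k) else f.
    rewrite nth_cat size_map; case: ltnP => kl; first by rewrite (nth_map 0%N).
    by have -> : (k - size mu = 0)%N by have := ltn_ord k; lia.
  rewrite !nthE; case: ltnP => [il|_]; case: ltnP => [jl|_]; rewrite ?diag //.
    by rewrite !bilin_pure /= part0 // nth_pos.
  by rewrite !bilin_pure /= Qcoef_anti part0 // nth_pos.
rewrite /Qseq (negPf mu_even) /Qpf /= cats0 map_cat -catA /=.
have -> : (size mu + 1 + 1 = (size mu + 0).+2)%N by lia.
pose d : seq (R * option nat) := [:: (1, Some 0%N); (-1, None)].
rewrite (@pfseq_linear _ _ _ _ _ _ [:: d; infty] (fun=> 1) id).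
- rewrite big_cons big_seq1 !mul1r [X in _ + X](_ : _ = 0) ?addr0; last first.
    have := @pfseq_swap R _ [::] (size mu + 0).+2 (bilin (Qker B))
      [seq part a | a <- mu] [::] infty infty.
    by rewrite size_map addn0 addn2 => /(_ erefl); lra.
  apply: pfseq_border => //; rewrite ?size_map ?addn0 //.
  + move=> e [->|]; first exact: diag.
    move=> e_in; have [b b0 ->] : exists2 b, (0 < b)%N & e = part b.
      elim: (mu) mu0 e_in => //= m mu' IHmu; rewrite inE negb_or => /andP[m0 mu0].
      case=> [<-|]; last exact: IHmu.
      by exists m => //; rewrite lt0n eq_sym.
    rewrite bilinl big_cons big_seq1 /= !bilin_pure /= Qcoef_anti part0 //; ring.
  + by rewrite bilinl big_cons big_seq1 /= !bilin_pure /= qfun0; ring.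
- by rewrite size_map /=; lia.
- by rewrite addn0 /= negbK.
- move=> e; rewrite big_cons big_seq1 !mul1r [bilin _ d e]bilinl big_cons big_seq1 /=.
  by rewrite /infty /part; ring.
- move=> e; rewrite big_cons big_seq1 !mul1r [bilin _ e d]bilinr big_cons big_seq1 /=.
  by rewrite /infty /part; ring.
Qed.

(** The Pfaffian for [x :: B] is expanded by multilinearity and then
    straightened by antisymmetry. *)
Theorem Qseq_branching x B k la : la \in strict_seqs k ->
  Qseq la (x :: B) =
  \sum_(mu <- strict_seqs k) transfer 2 1 x k false la mu * Qseq mu B.
Proof.
move=> lak; have /and3P[_ la0 _] : [&& sorted gtn la, 0%N \notin la & all (leq^~ k) la].
  by rewrite -mem_strict_seqs.
set n := (size la + odd (size la))%N; set o := nat_of_bool (odd (size la)).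
have n_even : ~~ odd n by rewrite oddD oddb addbb.
rewrite /Qseq -/n -/o Qpf_cons //.
rewrite (@pfseq_lower_all x B n [::]) ?size_nseq //.
have [straighten _] := lower_all_straighten x lak; rewrite straighten; last first.
  move=> u v a b sz; rewrite !map_cat -!catA /=; apply: pfseq_swap.
  by rewrite size_map size_cat size_map size_nseq /n -sz; lia.
rewrite !big_seq; apply: eq_bigr => mu muk.
have [->|nz] := eqVneq (transfer 2 1 x k false la mu) 0; first by rewrite !mul0r.
congr (_ * _); have := transfer_size lak muk nz; rewrite addn0 => /andP[le1 le2].
have /and3P[_ mu0 _] : [&& sorted gtn mu, 0%N \notin mu & all (leq^~ k) mu].
  by rewrite -mem_strict_seqs.
move: le1; rewrite leq_eqVlt => /predU1P[eq_sz|lt_sz].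
  by rewrite eq_sz subnn cats0 /n /o -eq_sz.
have eq_sz : size la = (size mu).+1 by apply/eqP; rewrite eqn_leq le2.
rewrite eq_sz subSn // subnn -[RHS]Qpf_zero // /n /o eq_sz /=.
by rewrite addn1.
Qed.

End Branching.

(** * Linear independence of the Q-functions *)

Section Independence.
Variable R : realType.
Implicit Types (x : R) (la mu nu : seq nat).

Lemma horner_transfer x k s la mu :
  (transfer 2 1 ('X : {poly R}) k s la mu).[x] = transfer 2 1 x k s la mu.
Proof.
elim: k s => [|k IHk] s; first by rewrite hornerC.
rewrite !transferS hornerM IHk /site_weight; congr (_ * _).
by case: s (k.+1 \in la) (k.+1 \in mu) => [] [] []; rewrite !hornerE.
Qed.

Lemma size_transfer k s la mu :
  (size (transfer 2 1 ('X : {poly R}) k s la mu) <= k.+1)%N.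
Proof.
elim: k s => [|k IHk] s; first by rewrite size_poly1.
have w2 b m : (size (site_weight 2 1 ('X : {poly R}) s b m) <= 2)%N.
  rewrite /site_weight; case: s b m => [] [] [] /=;
    rewrite ?expr1 ?expr0 ?size_polyX ?size_poly1 ?size_poly0 //.
  by rewrite mulr_natl mulr2n (leq_trans (size_polyD _ _)) // size_polyX.
rewrite !transferS.
apply: leq_trans (size_polyMleq _ _) _.
by rewrite -subn1 leq_subLR (leq_trans (leq_add (w2 _ _) (IHk _))).
Qed.

(** To collect [x ^+ k] the state must be true at each of the [k] levels, so
    [la] and [mu] agree. *)
Lemma lead_transfer k la mu : la \in strict_seqs k -> mu \in strict_seqs k ->
  (transfer 2 1 ('X : {poly R}) k true la mu)`_k = (la == mu)%:R.
Proof.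
elim: k la mu => [|k IHk] la mu.
  by rewrite !mem_seq1 => /eqP -> /eqP ->; rewrite coef1.
case/strict_seqsS => [lak|[la' lak ->]]; case/strict_seqsS => [muk|[mu' muk ->]].
- by rewrite transferS00 // expr1 coefXM /= IHk.
- rewrite transferS01 // mul1r nth_default ?size_transfer //.
  case: eqP => // eq_la; have := notin_strict_seqs lak (leqnn _).
  by rewrite eq_la mem_head.
- rewrite transferS10 // mul0r coef0; case: eqP => // eq_mu.
  by have := notin_strict_seqs muk (leqnn _); rewrite -eq_mu mem_head.
- by rewrite transferS11 expr1 coefXM /= IHk // eqseq_cons eqxx.
Qed.

(** In [Q_mu(x, B)], the power [x ^+ k.+1] occurs only if the largest part of
    [mu] is [k.+1], with coefficient [2 * Q_{mu'}(B)] where [mu'] is [mu]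
    without this part. A relation between the [Q_mu] therefore yields one
    between the [Q_{mu'}], and all coefficients vanish by induction. *)
Lemma Qseq_free k (c : seq nat -> R) :
    (forall B, \sum_(mu <- strict_seqs k) c mu * Qseq mu B = 0) ->
  forall mu, mu \in strict_seqs k -> c mu = 0.
Proof.
elim: k c => [|k IHk] c c0.
  move=> mu; rewrite mem_seq1 => /eqP ->; have := c0 [::]; rewrite big_seq1.
  suff -> : Qseq [::] ([::] : seq R) = 1 by rewrite mulr1.
  rewrite /Qseq /Qpf /pfseq /pfaffian /= expr0 mul1r invr1 mul1r.
  rewrite (big_pred1 1%g) => [|s]; last by apply/esym/eqP/permP => -[].
  by rewrite odd_perm1 big_pred0 ?mulr1 // => -[].
have top_zero mu1 : mu1 \in strict_seqs k -> c (k.+1 :: mu1) = 0.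
  suff H B : \sum_(mu <- strict_seqs k) 2 * c (k.+1 :: mu) * Qseq mu B = 0.
    by move=> muk; have /eqP := IHk _ H mu1 muk; rewrite mulf_eq0 pnatr_eq0 /= => /eqP.
  pose P := \sum_(mu <- strict_seqs k.+1) c mu *: \sum_(nu <- strict_seqs k.+1)
      Qseq nu B *: transfer 2 1 ('X : {poly R}) k.+1 false mu nu.
  have P0 : P = 0.
    apply/eqP; case: eqP => // /eqP P_nz.
    have Proot x : root P x.
      rewrite /root /P horner_sum; apply/eqP; rewrite -[RHS](c0 (x :: B)).
      rewrite !big_seq; apply: eq_bigr => mu muk.
      rewrite hornerZ horner_sum (Qseq_branching _ _ muk); congr (_ * _).
      by apply: eq_bigr => nu _; rewrite hornerZ horner_transfer mulrC.
    pose s := [seq (i%:R : R) | i <- iota 0 (size P)].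
    have : (size s < size P)%N.
      apply: max_poly_roots => //; first by apply/allP => x _; exact: Proot.
      by rewrite map_inj_uniq ?iota_uniq // => i j /eqP; rewrite eqr_nat => /eqP.
    by rewrite size_map size_iota ltnn.
  have := congr1 (fun p : {poly R} => p`_k.+1) P0; rewrite coef0 /P coef_sum.
  rewrite big_strict_seqs [X in X + _]big1_seq ?add0r => [top|mu /andP[_ muk]]; last first.
    rewrite coefZ coef_sum big1_seq ?mulr0 // => nu /andP[_ nuk].
    rewrite coefZ; move: nuk => /strict_seqsS [nuk|[nu' nuk ->]].
      by rewrite transferS00 // expr0 mul1r nth_default ?mulr0 ?size_transfer.
    by rewrite transferS01 // mul0r coef0 mulr0.
  rewrite -[RHS]top big_seq [RHS]big_seq; apply: eq_bigr => mu muk.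
  rewrite coefZ coef_sum.
  rewrite -mulrA mulrCA; congr (_ * _); rewrite big_strict_seqs.
  rewrite [X in _ = _ + X]big1_seq ?addr0 => [|nu /andP[_ nuk]]; last first.
    by rewrite coefZ transferS11 expr0 mul1r nth_default ?mulr0 ?size_transfer.
  rewrite (bigD1_seq mu) ?uniq_strict_seqs //= big1_seq ?addr0 => [|nu /andP[nu_mu nuk]].
    rewrite coefZ transferS10 // -mulrA mulr_natl coefMn coefXM /= lead_transfer //.
    by rewrite eqxx mulrC.
  rewrite coefZ transferS10 // -mulrA mulr_natl coefMn coefXM /= lead_transfer //.
  by rewrite eq_sym (negPf nu_mu) mul0rn mulr0.
move=> mu /strict_seqsS[muk|[mu' muk ->]]; last exact: top_zero.
apply: IHk muk => B; have := c0 B; rewrite big_strict_seqs.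
rewrite [X in _ + X]big1_seq ?addr0 // => nu /andP[_ nuk].
by rewrite top_zero // mul0r.
Qed.

End Independence.

(** * Commutation of the transfer weights *)

Section Commutation.
Variables (R : realType) (x y : R) (nu ka : seq nat).

(** The partitions that matter in [above] contain [nu] and [ka], those that matter
    in [below] are contained in both. The states [s] and [t] belong to the two factors. *)
Definition above k s t : R := \sum_(la <- strict_seqs k)
  transfer 2 1 x k s la nu * transfer 1 2 y k t la ka.

Definition below k s t : R := \sum_(rh <- strict_seqs k)
  transfer 1 2 y k s nu rh * transfer 2 1 x k t ka rh.

Lemma aboveS k s t : above k.+1 s t = \sum_(b : bool)
  site_weight 2 1 x s b (k.+1 \in nu) * site_weight 1 2 y t b (k.+1 \in ka) *
  above k (next_state s b (k.+1 \in nu)) (next_state t b (k.+1 \in ka)).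
Proof.
rewrite {1}/above big_strict_seqs big_bool /= addrC /above !big_distrr /=.
congr (_ + _).
  rewrite !big_seq; apply: eq_bigr => la lak; rewrite !transferS.
  by rewrite !(negPf (notin_strict_seqs lak (leqnn _))); ring.
by apply: eq_bigr => la _; rewrite !transferS !mem_head !transfer_consl //; ring.
Qed.

Lemma belowS k s t : below k.+1 s t = \sum_(b : bool)
  site_weight 1 2 y s (k.+1 \in nu) b * site_weight 2 1 x t (k.+1 \in ka) b *
  below k (next_state s (k.+1 \in nu) b) (next_state t (k.+1 \in ka) b).
Proof.
rewrite {1}/below big_strict_seqs big_bool /= addrC /below !big_distrr /=.
congr (_ + _).
  rewrite !big_seq; apply: eq_bigr => la lak; rewrite !transferS.
  by rewrite !(negPf (notin_strict_seqs lak (leqnn _))); ring.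
by apply: eq_bigr => la _; rewrite !transferS !mem_head !transfer_consr //; ring.
Qed.

(** A relation between the sums over [la] and over [rh] that is propagated by
    every way of occupying one site, so that it can be checked site by site. The
    states [s] and [t] have opposite differences on the two sides, which is why
    [false true] corresponds to [true false]. *)
Lemma above_below k : 1 + x * y != 0 ->
  [/\ above k false false = ((1 - x * y) * below k false false
                             + 2 * (x * y) * below k true true) / (1 + x * y),
      above k true true = (2 * below k false false
                           - (1 - x * y) * below k true true) / (1 + x * y),
      above k false true = below k true false &
      above k true false = below k false true].
Proof.
move=> p1; elim: k => [|k [IH00 IH11 IH01 IH10]].
  rewrite /above /below !big_seq1 /=; split; field => //.
split; rewrite !aboveS !belowS !big_bool /site_weight /next_state /=;
  case: (k.+1 \in nu); case: (k.+1 \in ka); rewrite /= ?IH00 ?IH11 ?IH01 ?IH10 ?expr1 ?expr0;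
  field => //.
Qed.

Lemma above_tail k j : (forall i, (k < i)%N -> i \notin nu) ->
    (forall i, (k < i)%N -> i \notin ka) ->
  above (k + j) true true = (x * y) ^+ j * above k true true /\
  below (k + j) false false = below k false false.
Proof.
move=> nuk kak; elim: j => [|j [IH1 IH2]]; first by rewrite addn0 expr0 mul1r.
rewrite addnS aboveS belowS !big_bool.
rewrite !(negPf (nuk _ _)) ?(negPf (kak _ _)) ?ltnS ?leq_addr //.
rewrite /site_weight /next_state /= IH1 IH2 (exprS _ j) expr1 expr0; split; ring.
Qed.

End Commutation.

(** * The kernel as a product *)

Section Kernel.
Variable R : realType.
Implicit Types (t : R) (X Y : seq R).

Definition odd_poly_log N : {poly R} :=
  \sum_(1 <= n < N | odd n) n%:R^-1 *: 'X^n.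

Lemma deriv_odd_poly_log N t :
  (1 - t ^+ 2) * (odd_poly_log N)^`().[t] = 1 - t ^+ (N./2).*2.
Proof.
rewrite /odd_poly_log; elim: N => [|[|N] IHN].
- by rewrite big_geq // deriv0 horner0 mulr0 expr0 subrr.
- by rewrite big_geq // deriv0 horner0 mulr0 expr0 subrr.
rewrite big_mkcond big_nat_recr //= -big_mkcond /= derivD hornerD mulrDr IHN.
have [N_odd|N_even] /= := boolP (odd N).
  rewrite deriv0 horner0 mulr0 addr0; congr (_ - _ ^+ _.*2); move: N_odd; lia.
rewrite derivZ derivXn hornerZ hornerMn hornerXn /= -[t ^+ N *+ _]mulr_natl mulKf ?pnatr_eq0 //.
have -> : (uphalf N).*2 = N by move: N_even; lia.
have -> : (N./2.+1).*2 = N.+2 by move: N_even; lia.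
by rewrite !exprS; ring.
Qed.

(** The derivative of the difference is [2 t^m / (1 - t^2)], with [m] the even
    number [(N.+1)./2.*2], at least [N]; the mean value theorem bounds the
    difference itself. *)
Lemma log_ratio_bound N t : 0 <= t < 1 ->
  `|ln ((1 + t) / (1 - t)) - 2 * (odd_poly_log N.+1).[t]| <=
    2 / (1 - t ^+ 2) * t ^+ N.
Proof.
move=> /andP[t0 t1].
pose f (u : R) := ln (1 + u) - ln (1 - u) - 2 * (odd_poly_log N.+1).[u].
pose df (u : R) : R := 2 * u ^+ (N.+1./2).*2 / (1 - u ^+ 2).
have f_der (u : R) : 0 <= u < 1 -> is_derive u 1 f (df u).
  move=> /andP[u0 u1].
  have lnP : is_derive u (1 : R) (fun v : R => ln (1 + v)) ((1 + u)^-1).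
    have dln := @is_derive1_ln R (1 + u) (ltr_wpDr u0 ltr01).
    have dadd : is_derive u (1 : R) (fun v : R => 1 + v) 1.
      by rewrite -[X in is_derive _ _ _ X]add0r; apply: is_deriveD.
    by rewrite -[X in is_derive _ _ _ X]mulr1; exact: (is_derive1_comp dln dadd).
  have lnN : is_derive u (1 : R) (fun v : R => ln (1 - v)) (- (1 - u)^-1).
    have u10 : 0 < 1 - u by rewrite subr_gt0.
    have dln := is_derive1_ln u10.
    have dsub : is_derive u (1 : R) (fun v : R => 1 - v) (- 1).
      by rewrite -[X in is_derive _ _ _ X]add0r; apply: is_deriveD.
    by have := @is_derive1_comp _ (@ln R) (fun v : R => 1 - v) u _ _ dln dsub; rewrite mulrN1.
  apply: (@is_derive_eq _ _ _ f u 1 _ ((1 + u)^-1 - (- (1 - u)^-1) -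
     2 *: (odd_poly_log N.+1)^`().[u])).
  have u2 : 1 - u ^+ 2 != 0 by rewrite gt_eqF // subr_gt0 expr_lt1.
  have := deriv_odd_poly_log N.+1 u.
  rewrite /df; set p := _.[u]; set q := u ^+ _.*2 => pE.
  have -> : q = 1 - (1 - u ^+ 2) * p by rewrite pE subKr.
  rewrite /GRing.scale /=; field.
  have u3 : 1 + u != 0 by rewrite gt_eqF // ltr_wpDr.
  have u4 : 1 - u != 0 by rewrite gt_eqF // subr_gt0.
  by rewrite u3 u4 u2.
have f_cont : {within `[0, t], continuous f}.
  apply: derivable_within_continuous => u; rewrite in_itv /= => /andP[u0 ut].
  by have [] := f_der u; rewrite ?u0 ?(le_lt_trans ut).
have f_der_in (u : R) : u \in `]0, t[%R -> is_derive u 1 f (df u).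
  by rewrite in_itv /= => /andP[u0 ut]; apply: f_der; rewrite ltW ?(lt_trans ut).
have [c c_in fE] := MVT_segment t0 f_der_in f_cont.
have f0 : f 0 = 0.
  rewrite /f addr0 subr0 subrr sub0r; apply/eqP; rewrite oppr_eq0 mulf_eq0; apply/orP; right.
  rewrite /odd_poly_log horner_sum big_seq_cond big1 // => n /andP[_ n_odd].
  by rewrite hornerZ hornerXn expr0n; case: n n_odd => // n _; rewrite mulr0.
move: fE; rewrite f0 !subr0 => fE.
rewrite ln_div; [|by rewrite posrE ltr_wpDr|by rewrite posrE subr_gt0].
rewrite -/(f t) fE; move: c_in; rewrite in_itv /= => /andP[c0 ct].
have t2 : 0 < 1 - t ^+ 2 by rewrite subr_gt0 expr_lt1.
have c2 : 1 - t ^+ 2 <= 1 - c ^+ 2 by rewrite lerD2l lerN2 lerXn2r ?nnegrE.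
have c2' := lt_le_trans t2 c2.
have ci0 : 0 <= (1 - c ^+ 2)^-1 by rewrite invr_ge0 ltW.
have ck0 k : 0 <= c ^+ k by exact: exprn_ge0.
rewrite ger0_norm; last by rewrite /df !mulr_ge0.
have le_pow : c ^+ (N.+1./2).*2 <= t ^+ N.
  apply: (@le_trans _ _ (t ^+ (N.+1./2).*2)); first by rewrite lerXn2r ?nnegrE.
  by apply: ler_wiXn2l; rewrite ?(ltW t1) //; lia.
have le_inv : (1 - c ^+ 2)^-1 <= (1 - t ^+ 2)^-1 by rewrite lef_pV2 ?posrE.
apply: (@le_trans _ _ (df c)); first by rewrite ler_piMr ?(ltW t1) // /df !mulr_ge0.
by rewrite /df mulrAC ler_pM ?mulr_ge0 ?ler_pM.
Qed.

Lemma log_ratio_series t : 0 <= t < 1 ->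
  (fun N => 2 * (odd_poly_log N).[t]) @ \oo --> ln ((1 + t) / (1 - t)).
Proof.
move=> t01; have /andP[t0 t1] := t01.
rewrite -(cvg_shiftS (fun N => 2 * (odd_poly_log N).[t])).
have geo : (fun N => 2 / (1 - t ^+ 2) * t ^+ N) @ \oo --> (0 : R).
  rewrite -(mulr0 (2 / (1 - t ^+ 2))); apply: cvgMl_tmp.
  by apply: cvg_expr; rewrite ger0_norm.
apply/cvgrPdist_le => e e0; move/cvgrPdist_le: geo => /(_ e e0).
apply: filterS => N; rewrite sub0r normrN; apply: le_trans.
exact: le_trans (log_ratio_bound N t01) (ler_norm _).
Qed.

Lemma cvg_sum_seq (I : eqType) (r : seq I) (u : I -> nat -> R) (l : I -> R) :
    (forall i, i \in r -> u i @ \oo --> l i) ->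
  (fun N => \sum_(i <- r) u i N) @ \oo --> \sum_(i <- r) l i.
Proof.
elim: r => [|i r IHr] ul.
  by rewrite big_nil; under eq_cvg do rewrite big_nil; exact: cvg_cst.
rewrite big_cons; under eq_cvg do rewrite big_cons.
apply: cvgD; first by apply: ul; rewrite mem_head.
by apply: IHr => j jr; apply: ul; rewrite in_cons jr orbT.
Qed.

(** [p_n(X) p_n(Y)] is the sum of the [(x y)^n], and the sum of [t^n / n] over
    odd [n] is half the logarithm of [(1 + t) / (1 - t)]. *)
Lemma Hker_prod X Y : (forall x y, x \in X -> y \in Y -> 0 <= x * y < 1) ->
  Hker X Y = \prod_(x <- X) \prod_(y <- Y) ((1 + x * y) / (1 - x * y)).
Proof.
move=> XY; have powersE N : \sum_(1 <= n < N | odd n) psum n X * psum n Y / n%:R =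
    2^-1 * \sum_(x <- X) \sum_(y <- Y) 2 * (odd_poly_log N).[x * y].
  under [X in _ = _ * X]eq_bigr do rewrite -big_distrr.
  rewrite -big_distrr mulKf ?pnatr_eq0 //= /odd_poly_log.
  transitivity (\sum_(x <- X) \sum_(1 <= n < N | odd n) \sum_(y <- Y)
                  (n%:R^-1 *: 'X^n : {poly R}).[x * y]).
    rewrite exchange_big /=; apply: eq_bigr => n _.
    rewrite /psum mulr_suml mulr_suml; apply: eq_bigr => x _.
    rewrite mulr_sumr mulr_suml; apply: eq_bigr => y _.
    by rewrite hornerZ hornerXn exprMn mulrC.
  apply: eq_bigr => x _; rewrite exchange_big /=; apply: eq_bigr => y _.
  by rewrite horner_sum.
rewrite /Hker; have -> : limn (fun N : nat =>
    \sum_(1 <= n < N | odd n) psum n X * psum n Y / n%:R) =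
    2^-1 * \sum_(x <- X) \sum_(y <- Y) ln ((1 + x * y) / (1 - x * y)).
  apply: cvg_lim => //; under eq_cvg do rewrite powersE.
  apply: cvgMl_tmp; apply: cvg_sum_seq => x xX; apply: cvg_sum_seq => y yY.
  exact: log_ratio_series (XY _ _ xX yY).
rewrite mulVKf ?pnatr_eq0 // expR_sum !big_seq; apply: eq_bigr => x xX.
rewrite expR_sum !big_seq; apply: eq_bigr => y yY.
have /andP[xy0 xy1] := XY _ _ xX yY.
by rewrite lnK // posrE divr_gt0 ?subr_gt0 // ltr_wpDr.
Qed.

End Kernel.

(** * Sums of nonnegative families *)

Section NonnegativeSums.
Variables (R : realType) (T : choiceType).
Implicit Types (f : T -> R).

Lemma esumZl (c : R) (a : T -> \bar R) : 0 <= c -> (forall i, (0 <= a i)%E) ->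
  (\esum_(i in [set: T]) (c%:E * a i) = c%:E * \esum_(i in [set: T]) a i)%E.
Proof.
have le_scale (d : R) (b : T -> \bar R) : 0 <= d -> (forall i, (0 <= b i)%E) ->
    (\esum_(i in [set: T]) (d%:E * b i) <= d%:E * \esum_(i in [set: T]) b i)%E.
  move=> d0 b0; apply: ge_ereal_sup => /= _ [F [finF _] <-].
  rewrite -ge0_mule_fsumr //; apply: lee_wpmul2l; first by rewrite lee_fin.
  by apply: esum_ge; exists F.
move=> c0 a0; apply/eqP; rewrite eq_le le_scale //=.
have [->|c_neq0] := eqVneq c 0.
  by rewrite mul0e esum_ge0 // => i _; rewrite mul0e.
have {c_neq0} c0 : 0 < c by rewrite lt_neqAle eq_sym c_neq0 c0.
have ca0 i : (0 <= c%:E * a i)%E by rewrite mule_ge0 // lee_fin ltW.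
have -> : (\esum_(i in [set: T]) a i =
           \esum_(i in [set: T]) (c^-1%:E * (c%:E * a i)))%E.
  by apply: eq_esum => i _; rewrite muleA -EFinM mulVf ?mul1e // gt_eqF.
have := le_scale c^-1 _ _ ca0; rewrite invr_ge0 ltW // => /(_ isT) le_inv.
apply: le_trans (lee_wpmul2l _ le_inv) _; first by rewrite lee_fin ltW.
by rewrite muleA -EFinM mulfV ?gt_eqF // mul1e.
Qed.

Lemma esum_scale (c : R) f (l : R) : 0 <= c -> (forall i, 0 <= f i) ->
    (\esum_(i in [set: T]) (f i)%:E = l%:E)%E ->
  (\esum_(i in [set: T]) (c * f i)%:E = (c * l)%:E)%E.
Proof.
by move=> c0 f0 fl; rewrite EFinM -fl -esumZl.
Qed.

Lemma esum0_eq0 f : (forall i, 0 <= f i) ->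
  (\esum_(i in [set: T]) (f i)%:E = 0)%E -> forall i, f i = 0.
Proof.
move=> f0 sum0 i; apply/eqP; rewrite eq_le f0 andbT -lee_fin.
rewrite -[leRHS]sum0; apply: esum_ge; exists [set i]; first by split => //; exact: finite_set1.
by rewrite fsbig_set1.
Qed.

Lemma esum_finite (r : seq T) f : uniq r -> (forall i, 0 <= f i) ->
    (forall i, i \notin r -> f i = 0) ->
  (\esum_(i in [set: T]) (f i)%:E = (\sum_(i <- r) f i)%:E)%E.
Proof.
move=> r_uniq f0 fr; rewrite -sumEFin fsbig_seq // -esum_fset; last 2 first.
- exact: finite_seq.
- by move=> i _; rewrite lee_fin.
rewrite [RHS]esum_mkcond; apply: eq_esum => i _.
by case: ifPn => //; rewrite notin_setE /= => /negP /fr ->.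
Qed.

Lemma esum_exchange (T' : choiceType) (a : T -> T' -> R) :
    (forall i j, 0 <= a i j) ->
  (\esum_(i in [set: T]) \esum_(j in [set: T']) (a i j)%:E =
   \esum_(j in [set: T']) \esum_(i in [set: T]) (a i j)%:E)%E.
Proof.
move=> a0; rewrite !esum_esum; try by move=> *; rewrite lee_fin.
rewrite (@reindex_esum _ _ _ ([set: T'] `*`` fun=> [set: T])
   ([set: T] `*`` fun=> [set: T']) (fun p => (p.2, p.1))) //.
split => [p _|p q _ _ [h1 h2]|[i j] _] //=; first by case: p q h1 h2 => ? ? [? ?] /= -> ->.
by exists (j, i).
Qed.

End NonnegativeSums.

(** * Sums over strict partitions *)

Section PartitionSums.
Variable R : realType.
Implicit Types (la mu nu ka : strict_partition).

Definition empty_partition : strict_partition := @StrictPartition [::] isT.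

Definition to_partition (s : seq nat) : strict_partition := insubd empty_partition s.

Definition partitions (N : nat) : seq strict_partition :=
  [seq to_partition s | s <- strict_seqs N].

Lemma to_partitionK N s : s \in strict_seqs N -> to_partition s = s :> seq nat.
Proof.
rewrite mem_strict_seqs => /and3P[ss s0 _].
by rewrite /to_partition; apply: insubdK; rewrite /in_mem /= ss.
Qed.

Lemma to_partition_parts la : to_partition la = la.
Proof. exact: valKd. Qed.

Lemma mem_strict_seqs_parts la N : (parts la \in strict_seqs N) = (head 0 la <= N)%N.
Proof.
rewrite mem_strict_seqs; case: la => la /= /andP[ss s0]; rewrite ss s0 /=.
case: la ss {s0} => //= a la; rewrite path_sortedE; last first.
  by move=> ? ? ? /= h1 h2; apply: ltn_trans h2 h1.
case/andP=> /allP sa _; case: (leqP a N) => //= aN; apply/allP => i /sa /= ia.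
by apply: leq_trans aN; exact: ltnW.
Qed.

Lemma mem_partitions la N : (la \in partitions N) = (head 0 la <= N)%N.
Proof.
rewrite -mem_strict_seqs_parts; apply/mapP/idP => [[s sN ->]|laN].
  by rewrite (to_partitionK sN).
by exists (parts la); rewrite ?to_partition_parts.
Qed.

Lemma uniq_partitions N : uniq (partitions N).
Proof.
rewrite map_inj_in_uniq ?uniq_strict_seqs // => s t sN tN /(congr1 parts).
by rewrite (to_partitionK sN) (to_partitionK tN).
Qed.

Lemma big_partitions N (F : seq nat -> R) :
  \sum_(la <- partitions N) F la = \sum_(s <- strict_seqs N) F s.
Proof.
rewrite big_map !big_seq; apply: eq_bigr => s sN.
by rewrite (to_partitionK sN).
Qed.

(** The partial sums over partitions with parts at most [N] are cofinal among
    all finite partial sums. *)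
Lemma esum_partitions (f : strict_partition -> R) (l : R) :
    (forall la, 0 <= f la) ->
    (fun N => \sum_(la <- partitions N) f la) @ \oo --> l ->
  (\esum_(la in [set: strict_partition]) (f la)%:E = l%:E)%E.
Proof.
move=> f0 fl; set S := fun N => _ in fl.
have SE N : (S N)%:E = (\sum_(la \in [set` partitions N]) (f la)%:E)%E.
  by rewrite -sumEFin fsbig_seq ?uniq_partitions.
have S_le N M : (N <= M)%N -> S N <= S M.
  move=> NM; rewrite -lee_fin !SE; apply: lee_fsum_nneg_subset.
  - exact: finite_seq.
  - exact: finite_seq.
  - by move=> la; rewrite !inE /= !mem_partitions => /leq_trans ->.
  - by move=> la _; rewrite lee_fin.
have S_lel N : S N <= l.
  rewrite -(cvg_lim _ fl) //; apply: nondecreasing_cvgn_le => //.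
  by apply/cvg_ex; exists l.
apply/eqP; rewrite eq_le; apply/andP; split.
  apply: ge_ereal_sup => /= _ [F [finF _] <-].
  have /finite_seqP[r Fr] := finF.
  pose N := (\max_(la <- r) head 0%N (la : strict_partition))%N.
  apply: (@le_trans _ _ (S N)%:E); last by rewrite lee_fin.
  rewrite SE; apply: lee_fsum_nneg_subset => //.
  - exact: finite_seq.
  - move=> la; rewrite !inE /= mem_partitions => Fla.
    apply: (@leq_bigmax_seq _ _ _ (fun la : strict_partition => head 0%N la)) => //.
    by move: Fla; rewrite Fr.
  - by move=> la _; rewrite lee_fin.
have S_esum N : ((S N)%:E <= \esum_(la in [set: strict_partition]) (f la)%:E)%E.
  rewrite SE; apply: esum_ge; exists [set` partitions N] => //.
  by split => //; exact: finite_seq.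
case E : (esum _ _) S_esum => [r| |] S_esum //=; rewrite ?leey //.
  rewrite lee_fin -(cvg_lim _ fl) //; apply: limr_le; first by apply/cvg_ex; exists l.
  by apply: nearW => N; rewrite -lee_fin.
by have := S_esum 0%N; rewrite leeNy_eq.
Qed.

End PartitionSums.

(** * Kernels of one variable *)

Section OneVariableKernels.
Variable R : realType.
Implicit Types (o c x y : R) (la mu nu ka rh : strict_partition).

Lemma transfer_widen o c x K N (la mu : seq nat) : (K <= N)%N ->
    la \in strict_seqs K -> mu \in strict_seqs K ->
  transfer o c x N false la mu = transfer o c x K false la mu.
Proof.
move=> KN laK muK; rewrite -(subnKC KN); elim: (N - K)%N => [|j IHj]; first by rewrite addn0.
have sub (s : seq nat) : s \in strict_seqs K -> s \in strict_seqs (K + j).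
  rewrite !mem_strict_seqs => /and3P[-> -> /allP sK] /=.
  by apply/allP => i /sK /leq_trans -> //; exact: leq_addr.
by rewrite addnS transferS00 ?sub // mul1r.
Qed.

(** In state true, a part of [la] above level [k] is not matched yet and may be
    counted as [k]. *)
Lemma transfer_nth o c x k s (la mu : seq nat) :
    la \in strict_seqs k -> mu \in strict_seqs k ->
    transfer o c x k s la mu != 0 ->
  forall i, (nth 0 mu i <= nth 0 (if s then k :: la else la) i)%N.
Proof.
have le_top n (v : seq nat) i : (nth 0 (n :: v) i <= nth 0 (n.+1 :: v) i)%N.
  by case: i => //= ; rewrite leqnSn.
elim: k s la mu => [|k IHk] s la mu.
  by rewrite !mem_seq1 => /eqP -> /eqP -> _ i; rewrite nth_nil.
have nz (a b : R) : a * b != 0 -> b != 0 by apply: contraNneq => ->; rewrite mulr0.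
case/strict_seqsS => [lak|[la' lak ->]]; case/strict_seqsS => [muk|[mu' muk ->]].
- rewrite transferS00 // => /nz/IHk mu_la i; apply: leq_trans (mu_la _ _ i) _ => //.
  by case: s {mu_la}.
- rewrite transferS01 // => T_nz; have /IHk mu_la := nz _ _ T_nz.
  case: s T_nz => [_|]; last by rewrite mul0r eqxx.
  by case=> [|i] //=; exact: mu_la.
- rewrite transferS10 // => T_nz; have /IHk mu_la := nz _ _ T_nz.
  case: s T_nz => [|_]; first by rewrite mul0r eqxx.
  by move=> i; apply: leq_trans (mu_la _ _ i) _.
- rewrite transferS11 => /nz/IHk mu_la.
  case: s mu_la => mu_la [|i] //=; last exact: mu_la.
  by apply: leq_trans (mu_la _ _ i) _.
Qed.

(** The weight does not depend on the starting level, provided that it is at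
    least all parts; this is the smallest such level. *)
Definition one_var o c x la mu : R :=
  transfer o c x (maxn (head 0%N la) (head 0%N mu)) false la mu.

Lemma one_varE o c x N la mu : (head 0 la <= N)%N -> (head 0 mu <= N)%N ->
  transfer o c x N false la mu = one_var o c x la mu.
Proof.
move=> laN muN; apply: transfer_widen; rewrite ?geq_max ?laN //.
  by rewrite mem_strict_seqs_parts leq_maxl.
by rewrite mem_strict_seqs_parts leq_maxr.
Qed.

Lemma one_var_contained o c x la mu : one_var o c x la mu != 0 -> contained mu la.
Proof.
move=> T_nz i; have := @transfer_nth o c x _ false la mu _ _ T_nz i.
by apply; rewrite mem_strict_seqs_parts ?leq_maxl ?leq_maxr.
Qed.

Lemma contained_head la mu : contained mu la -> (head 0 mu <= head 0 la)%N.
Proof. by move=> /(_ 0%N); rewrite !nth0. Qed.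

Lemma one_var0 o c x la mu : (head 0 la < head 0 mu)%N -> one_var o c x la mu = 0.
Proof.
move=> lt_la_mu; apply/eqP; apply: contraTT lt_la_mu => /one_var_contained.
by move/contained_head; rewrite -leqNgt.
Qed.

Lemma transfer_ge0 o c x k s (la mu : seq nat) : 0 <= o -> 0 <= c -> 0 <= x ->
  0 <= transfer o c x k s la mu.
Proof.
move=> o0 c0 x0; elim: k s => [|k IHk] s; first exact: ler01.
rewrite transferS mulr_ge0 // /site_weight.
by case: s (k.+1 \in la) (k.+1 \in mu) => [] [] [] //=; rewrite ?mulr_ge0 ?exprn_ge0.
Qed.

Lemma one_var_ge0 o c x la mu : 0 <= o -> 0 <= c -> 0 <= x ->
  0 <= one_var o c x la mu.
Proof. exact: transfer_ge0. Qed.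

(** Moving the factor 2 from the entries into state true to the exits
    accounts for the normalization [P_la = 2^-l(la) Q_la]. *)
Lemma transfer_gauge x k s (la mu : seq nat) :
    la \in strict_seqs k -> mu \in strict_seqs k ->
  transfer 1 2 x k s la mu * 2 ^+ size la = transfer 2 1 x k s la mu * 2 ^+ size mu.
Proof.
elim: k s la mu => [|k IHk] s la mu.
  by rewrite !mem_seq1 => /eqP -> /eqP ->.
case/strict_seqsS => [lak|[la' lak ->]]; case/strict_seqsS => [muk|[mu' muk ->]].
- by rewrite !transferS00 // -!mulrA IHk.
- rewrite !transferS01 //= exprS.
  have := IHk false _ _ lak muk; case: s => E; last by rewrite !mul0r.
  by rewrite -mulrA E; ring.
- rewrite !transferS10 //= exprS.
  have := IHk true _ _ lak muk; case: s => E; first by rewrite !mul0r.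
  by rewrite -[RHS]mulrA -E; ring.
- rewrite !transferS11 /= !exprS; have := IHk s _ _ lak muk => E.
  transitivity (2 * x ^+ s * (transfer 1 2 x k s la' mu' * 2 ^+ size la')); first by ring.
  by rewrite E; ring.
Qed.

Lemma Qfun_cons x B N la : (head 0 la <= N)%N ->
  Qfun la (x :: B) = \sum_(mu <- partitions N) one_var 2 1 x la mu * Qfun mu B.
Proof.
move=> laN; rewrite Qfun_Qseq (@Qseq_branching _ _ _ N) ?mem_strict_seqs_parts //.
rewrite -big_partitions !big_seq; apply: eq_bigr => mu; rewrite mem_partitions => muN.
by rewrite one_varE // Qfun_Qseq.
Qed.

Lemma Pfun_cons x B N la : (head 0 la <= N)%N ->
  Defs.Pfun la (x :: B) = \sum_(mu <- partitions N) one_var 1 2 x la mu * Defs.Pfun mu B.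
Proof.
move=> laN; rewrite /Defs.Pfun (Qfun_cons _ _ laN) mulr_sumr !big_seq.
apply: eq_bigr => mu; rewrite mem_partitions => muN.
have two0 n : 2 ^+ n != 0 :> R by rewrite expf_neq0 ?pnatr_eq0.
have := @transfer_gauge x N false la mu; rewrite !mem_strict_seqs_parts !one_varE //.
move=> /(_ laN muN) gauge.
have -> : one_var 2 1 x la mu = one_var 1 2 x la mu * 2 ^+ size la / 2 ^+ size mu.
  by rewrite gauge mulfK.
by field; rewrite !two0.
Qed.

Lemma Qfun_nil la : Qfun la [::] = (la == empty_partition)%:R :> R.
Proof.
have [->|la_neq] := eqVneq la empty_partition.
  rewrite /Qfun /pfaffian /= expr0 mul1r invr1 mul1r.
  rewrite (big_pred1 1%g) => [|s]; last by apply/esym/eqP/permP => -[].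
  by rewrite odd_perm1 big_pred0 ?mulr1 // => -[].
have la_gt0 : (0 < size la)%N.
  rewrite lt0n size_eq0; apply: contraNneq la_neq => la_nil.
  by apply/eqP/val_inj.
have la0 : 0%N \notin parts la by case: (la) => s /= /andP[].
have n_gt0 : (0 < size la + odd (size la))%N by rewrite addn_gt0 la_gt0.
rewrite Qfun_Qseq /Qseq /Qpf /pfseq /pfaffian big1 ?mulr0 // => s _.
rewrite (bigD1 (Ordinal n_gt0)) //= mxE !nth_parts //.
case: ifP => [i1|_]; case: ifP => [i2|_]; rewrite bilin_pure /=
  ?Qcoef_nil ?qfun_nil ?mul0r ?mulr0 // /e0.
  by rewrite -[_ == _]negbK -lt0n (nth_pos la0 i1) mul0r mulr0.
by rewrite -[_ == _]negbK -lt0n (nth_pos la0 i2) oppr0 mul0r mulr0.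
Qed.

End OneVariableKernels.

(** * Skew Q-functions *)

Section SkewQ.
Variable R : realType.
Implicit Types (A B X Y : seq R) (la mu nu ka rh : strict_partition).

Lemma contained_trans nu mu la : contained mu nu -> contained nu la -> contained mu la.
Proof. by move=> mn nl i; apply: leq_trans (mn i) (nl i). Qed.

(** The skew function [Q_{la/mu}(A)], by iterating the branching rule:
    a sum over chains from [mu] to [la]. *)
Fixpoint skew_sum A la mu : R :=
  if A is x :: A' then
    \sum_(nu <- partitions (head 0%N la)) one_var 2 1 x la nu * skew_sum A' nu mu
  else (la == mu)%:R.

Lemma skew_sum_ge0 A la mu : (forall a, a \in A -> 0 <= a) -> 0 <= skew_sum A la mu.
Proof.
elim: A la => [|x A IHA] la A0 /=; first exact: ler0n.
have x0 : 0 <= x by rewrite A0 ?mem_head.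
apply: sumr_ge0 => nu _; rewrite mulr_ge0 ?one_var_ge0 //.
by apply: IHA => a aA; rewrite A0 // in_cons aA orbT.
Qed.

Lemma skew_sum_contained A la mu : ~ contained mu la -> skew_sum A la mu = 0.
Proof.
elim: A la => [|x A IHA] la mu_la /=.
  by case: eqP => // la_mu; case: mu_la; rewrite la_mu.
rewrite big1 // => nu _; have [->|T_nz] := eqVneq (one_var 2 1 x la nu) 0.
  by rewrite mul0r.
rewrite IHA ?mulr0 // => mu_nu; apply: mu_la.
exact: contained_trans mu_nu (one_var_contained T_nz).
Qed.

Lemma Qfun_cat A B N la : (head 0 la <= N)%N ->
  Qfun la (A ++ B) = \sum_(mu <- partitions N) skew_sum A la mu * Qfun mu B.
Proof.
elim: A la => [|x A IHA] la laN /=.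
  rewrite (bigD1_seq la) ?mem_partitions ?uniq_partitions //= eqxx mul1r.
  by rewrite big1 ?addr0 // => mu; rewrite eq_sym => /negPf ->; rewrite mul0r.
rewrite (Qfun_cons _ _ (leqnn _)).
under [RHS]eq_bigr do rewrite mulr_suml.
rewrite exchange_big /= !big_seq; apply: eq_bigr => nu; rewrite mem_partitions => nu_la.
by rewrite IHA ?(leq_trans nu_la) // mulr_sumr; apply: eq_bigr => mu _; rewrite mulrA.
Qed.

Lemma sum_contained N la (F : strict_partition -> R) : (head 0 la <= N)%N ->
    (forall mu, ~ contained mu la -> F mu = 0) ->
  \sum_(mu \in [set mu | contained mu la]) F mu = \sum_(mu <- partitions N) F mu.
Proof.
move=> laN F0; apply: fsbig_fwiden.
- by move=> mu /= /contained_head mu_la; rewrite mem_partitions (leq_trans mu_la).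
- exact: uniq_partitions.
- by move=> mu [_ /F0].
Qed.

Lemma is_skewQ_skew_sum A la : is_skewQ la A (skew_sum A la).
Proof.
split=> [mu|B]; first exact: skew_sum_contained.
rewrite (Qfun_cat _ _ (leqnn _)) (sum_contained (leqnn _)) // => mu mu_la.
by rewrite skew_sum_contained ?mul0r.
Qed.

(** Linear independence of the finitely many [Q_mu] with [mu] in [la]. *)
Lemma is_skewQ_unique A la c d : is_skewQ la A c -> is_skewQ la A d -> c = d.
Proof.
move=> [c0 cE] [d0 dE]; apply/funext => mu.
have [mu_la|mu_la] := pselect (contained mu la); last by rewrite c0 ?d0.
apply/eqP; rewrite -subr_eq0; apply/eqP.
rewrite -[mu]to_partition_parts.
apply: (@Qseq_free R (head 0%N la) (fun s => c (to_partition s) - d (to_partition s))).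
  move=> B; rewrite -big_partitions.
  have term0 (e : strict_partition -> R) : (forall nu, ~ contained nu la -> e nu = 0) ->
      forall nu, ~ contained nu la -> e nu * Qfun nu B = 0.
    by move=> e0 nu /e0 ->; rewrite mul0r.
  have := cE B; rewrite dE !(sum_contained (leqnn _)); try exact: term0.
  move=> eq_cd; under eq_bigr do rewrite to_partition_parts -Qfun_Qseq mulrBl.
  by rewrite sumrB eq_cd subrr.
by rewrite mem_strict_seqs_parts contained_head.
Qed.

Lemma skewQE A la mu : skewQ la mu A = skew_sum A la mu.
Proof.
rewrite /skewQ.
have := xgetPex (fun=> 0) (ex_intro [set c | is_skewQ la A c] _ (is_skewQ_skew_sum A la)).
by move=> /is_skewQ_unique/(_ (is_skewQ_skew_sum A la)) ->.
Qed.

Lemma Qfun_skew A la : Qfun la A = skew_sum A la empty_partition.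
Proof.
rewrite -[A]cats0 (Qfun_cat _ _ (leqnn _)) cats0.
rewrite (bigD1_seq empty_partition) ?mem_partitions ?uniq_partitions //=.
rewrite Qfun_nil eqxx mulr1 big1 ?addr0 // => mu /negPf mu0.
by rewrite Qfun_nil mu0 mulr0.
Qed.

Lemma Pfun_ge0 Y la : (forall y, y \in Y -> 0 <= y) -> 0 <= Defs.Pfun la Y.
Proof.
move=> Y0; rewrite /Defs.Pfun mulr_ge0 ?invr_ge0 ?exprn_ge0 //.
by rewrite Qfun_skew skew_sum_ge0.
Qed.

Lemma Pfun_empty Y : Defs.Pfun empty_partition Y = 1.
Proof.
rewrite /Defs.Pfun /= expr0 invr1 mul1r; elim: Y => [|y Y IHY].
  by rewrite Qfun_nil eqxx.
rewrite (Qfun_cons _ _ (leqnn _)) /partitions /= big_seq1.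
have -> : to_partition [::] = empty_partition by exact: (to_partition_parts empty_partition).
by rewrite IHY mulr1.
Qed.

End SkewQ.

(** * The skew Cauchy identity *)

Section SkewCauchy.
Variable R : realType.
Implicit Types (x y : R) (X Y : seq R) (la mu nu ka rh : strict_partition).

(** Beyond the parts of [nu] and [ka], enlarging the bound on the parts of [la]
    adds the terms of a geometric series of ratio [x y]. *)
Lemma one_var_commute x y nu ka : 0 <= x -> 0 <= y -> x * y < 1 ->
  (\esum_(la in [set: strict_partition])
     (one_var 2 1 x la nu * one_var 1 2 y la ka)%:E =
   ((1 + x * y) / (1 - x * y) *
    \sum_(rh <- partitions (maxn (head 0%N nu) (head 0%N ka)))
       one_var 1 2 y nu rh * one_var 2 1 x ka rh)%:E)%E.
Proof.
move=> x0 y0 xy1; set K := maxn _ _.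
have nuK : (head 0 nu <= K)%N by rewrite leq_maxl.
have kaK : (head 0 ka <= K)%N by rewrite leq_maxr.
have xy0 : 0 <= x * y by rewrite mulr_ge0.
have p1 : 1 + x * y != 0 by rewrite gt_eqF // ltr_wpDr.
have m1 : 1 - x * y != 0 by rewrite gt_eqF // subr_gt0.
have -> : \sum_(rh <- partitions K) one_var 1 2 y nu rh * one_var 2 1 x ka rh =
          below x y nu ka K false false.
  rewrite /below -big_partitions !big_seq; apply: eq_bigr => rh.
  by rewrite mem_partitions => rhK; rewrite !one_varE.
apply: esum_partitions => [la|]; first by rewrite mulr_ge0 ?one_var_ge0.
rewrite -(@cvg_shiftn K).
have partialE j : \sum_(la <- partitions (j + K)) one_var 2 1 x la nu * one_var 1 2 y la ka =
    (1 + x * y) / (1 - x * y) * below x y nu ka K false false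
    + - (2 * (x * y) / (1 - x * y) * above x y nu ka K true true) * (x * y) ^+ j.
  have -> : \sum_(la <- partitions (j + K)) one_var 2 1 x la nu * one_var 1 2 y la ka =
            above x y nu ka (j + K) false false.
    rewrite /above -big_partitions !big_seq; apply: eq_bigr => la.
    rewrite mem_partitions => laK.
    by rewrite !one_varE // ?(leq_trans nuK) ?(leq_trans kaK) // leq_addl.
  have notin la i : (head 0 la <= K)%N -> (K < i)%N -> i \notin parts la.
    by rewrite -mem_strict_seqs_parts; exact: notin_strict_seqs.
  have [top bot] := @above_tail R x y nu ka K j (fun i => notin nu i nuK)
                       (fun i => notin ka i kaK).
  have [+ + _ _] := @above_below R x y nu ka (j + K) p1.
  rewrite [(j + K)%N]addnC top bot => -> h11.
  have -> : below x y nu ka (K + j) true true =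
      (2 * below x y nu ka K false false
       - (1 + x * y) * ((x * y) ^+ j * above x y nu ka K true true)) / (1 - x * y).
    by rewrite h11; field; rewrite p1 m1.
  by field; rewrite p1 m1.
under eq_cvg do rewrite /= partialE.
set a := (1 + x * y) / _ * _; set b := - (2 * _ / _ * _).
suff : (fun j => a + b * (x * y) ^+ j) @ \oo --> a + b * 0 by rewrite mulr0 addr0.
apply: cvgD; first exact: cvg_cst.
by apply: cvgMl_tmp; apply: cvg_expr; rewrite ger0_norm.
Qed.

Lemma factor_ge0 x y : 0 <= x -> 0 <= y -> x * y < 1 ->
  0 <= (1 + x * y) / (1 - x * y).
Proof.
move=> x0 y0 xy1; have xy0 : 0 <= x * y by exact: mulr_ge0.
by apply: divr_ge0; [exact: addr_ge0|rewrite subr_ge0 ltW].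
Qed.

(** Induction on [Y]: [P_la(y, Y)] is expanded by the branching rule, and the
    two transfer weights are exchanged. *)
Lemma one_var_Cauchy x Y nu : 0 <= x -> (forall y, y \in Y -> 0 <= y) ->
    (forall y, y \in Y -> x * y < 1) ->
  (\esum_(la in [set: strict_partition]) (one_var 2 1 x la nu * Defs.Pfun la Y)%:E =
   (\prod_(y <- Y) ((1 + x * y) / (1 - x * y)) * Defs.Pfun nu Y)%:E)%E.
Proof.
move=> x0; elim: Y nu => [|y Y IHY] nu Y0 xY1.
  have Pnil la : Defs.Pfun la [::] = (la == empty_partition)%:R :> R.
    rewrite /Defs.Pfun Qfun_nil; case: eqP => [->|_]; last by rewrite mulr0.
    by rewrite /= expr0 invr1 mul1r.
  rewrite big_nil mul1r (@esum_finite _ _ [:: empty_partition]) //.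
  - rewrite big_seq1 !Pnil eqxx mulr1; congr (_%:E).
    have [->|nu_neq] := eqVneq; first by [].
    apply: one_var0; rewrite /= ltnNge; apply: contra nu_neq.
    by rewrite -mem_strict_seqs_parts mem_seq1 => /eqP nu0; apply/eqP/val_inj.
  - by move=> la; rewrite mulr_ge0 ?one_var_ge0 // Pnil ler0n.
  - by move=> la; rewrite mem_seq1 => /negPf la0; rewrite Pnil la0 mulr0.
have y0 : 0 <= y by rewrite Y0 ?mem_head.
have xy1 : x * y < 1 by rewrite xY1 ?mem_head.
have {}Y0 z : z \in Y -> 0 <= z by move=> zY; rewrite Y0 // in_cons zY orbT.
have {}xY1 z : z \in Y -> x * z < 1 by move=> zY; rewrite xY1 // in_cons zY orbT.
have {}IHY := IHY _ Y0 xY1.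
have P0 la : 0 <= Defs.Pfun la Y by exact: Pfun_ge0.
have t0 la mu : 0 <= one_var 2 1 x la mu by exact: one_var_ge0.
have t0' la mu : 0 <= one_var 1 2 y la mu by exact: one_var_ge0.
set H := \prod_(z <- Y) _ in IHY; rewrite big_cons -/H.
set h := (1 + x * y) / (1 - x * y).
have h0 : 0 <= h by exact: factor_ge0.
have H0 : 0 <= H.
  by rewrite /H big_seq prodr_ge0 // => z zY; exact: factor_ge0 (Y0 _ zY) (xY1 _ zY).
transitivity (\esum_(la in [set: strict_partition]) \esum_(ka in [set: strict_partition])
    (one_var 2 1 x la nu * (one_var 1 2 y la ka * Defs.Pfun ka Y))%:E)%E.
  apply: eq_esum => la _; rewrite (Pfun_cons _ _ (leqnn _)) mulr_sumr.
  rewrite (@esum_finite _ _ (partitions (head 0%N la))) ?uniq_partitions //.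
    by move=> ka; do ?[exact: t0|exact: t0'|exact: P0|exact: h0|apply: mulr_ge0].
  by move=> ka; rewrite mem_partitions -ltnNge => /one_var0 ->; rewrite mul0r mulr0.
rewrite esum_exchange; last first.
  by move=> *; do ?[exact: t0|exact: t0'|exact: P0|exact: h0|apply: mulr_ge0].
transitivity (\esum_(ka in [set: strict_partition]) \esum_(rh in [set: strict_partition])
    ((h * one_var 1 2 y nu rh) * (one_var 2 1 x ka rh * Defs.Pfun ka Y))%:E)%E.
  apply: eq_esum => ka _.
  transitivity (\esum_(la in [set: strict_partition])
      (Defs.Pfun ka Y * (one_var 2 1 x la nu * one_var 1 2 y la ka))%:E)%E.
    by apply: eq_esum => la _; congr (_%:E); ring.
  rewrite (esum_scale _ _ (one_var_commute _ _ _ _ _)) //; last by move=> *; rewrite mulr_ge0.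
  rewrite (@esum_finite _ _ (partitions (maxn (head 0%N nu) (head 0%N ka)))) ?uniq_partitions //.
  - by congr (_%:E); rewrite !mulr_sumr; apply: eq_bigr => rh _; rewrite -/h; ring.
  - by move=> rh; do ?[exact: t0|exact: t0'|exact: P0|exact: h0|apply: mulr_ge0].
  - move=> rh; rewrite mem_partitions -ltnNge gtn_max => /andP[/one_var0 -> _].
    by rewrite mulr0 mul0r.
rewrite esum_exchange; last first.
  by move=> *; do ?[exact: t0|exact: t0'|exact: P0|exact: h0|apply: mulr_ge0].
transitivity (\esum_(rh in [set: strict_partition])
    ((h * H) * (one_var 1 2 y nu rh * Defs.Pfun rh Y))%:E)%E.
  apply: eq_esum => rh _; rewrite (esum_scale (mulr_ge0 h0 (t0' nu rh)) _ (IHY rh)).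
    by congr (_%:E); ring.
  by move=> ka; exact: mulr_ge0.
rewrite (@esum_finite _ _ (partitions (head 0%N nu))) ?uniq_partitions //.
- by congr (_%:E); rewrite (Pfun_cons _ _ (leqnn _)) mulr_sumr.
- by move=> rh; do ?[exact: t0|exact: t0'|exact: P0|exact: h0|apply: mulr_ge0].
- by move=> rh; rewrite mem_partitions -ltnNge => /one_var0 ->; rewrite mul0r mulr0.
Qed.

Lemma skew_Cauchy X Y mu : (forall x, x \in X -> 0 <= x) ->
    (forall y, y \in Y -> 0 <= y) ->
    (forall x y, x \in X -> y \in Y -> x * y < 1) ->
  (\esum_(la in [set: strict_partition]) (skewQ la mu X * Defs.Pfun la Y)%:E =
   (Hker X Y * Defs.Pfun mu Y)%:E)%E.
Proof.
move=> X0 Y0 XY1; rewrite Hker_prod; last first.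
  by move=> x y xX yY; rewrite XY1 // andbT; apply: mulr_ge0; [exact: X0|exact: Y0].
under eq_esum do rewrite skewQE.
have P0 la : 0 <= Defs.Pfun la Y by exact: Pfun_ge0.
elim: X X0 XY1 => [|x X IHX] X0 XY1.
  rewrite big_nil mul1r (@esum_finite _ _ [:: mu]) //=.
  - by rewrite big_seq1 eqxx mul1r.
  - by move=> la; rewrite mulr_ge0 ?ler0n.
  - by move=> la; rewrite mem_seq1 => /negPf ->; rewrite mul0r.
have x0 : 0 <= x by rewrite X0 ?mem_head.
have xY1 y : y \in Y -> x * y < 1 by apply: XY1; rewrite mem_head.
have {}X0 z : z \in X -> 0 <= z by move=> zX; rewrite X0 // in_cons zX orbT.
have {}XY1 z y : z \in X -> y \in Y -> z * y < 1.
  by move=> zX; apply: XY1; rewrite in_cons zX orbT.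
have {}IHX := IHX X0 XY1.
have t0 la nu : 0 <= one_var 2 1 x la nu by exact: one_var_ge0.
have s0 la nu : 0 <= skew_sum X la nu by exact: skew_sum_ge0.
rewrite big_cons; set h := \prod_(y <- Y) _.
have h0 : 0 <= h.
  by rewrite /h big_seq prodr_ge0 // => z zY; exact: factor_ge0 (Y0 _ zY) (xY1 _ zY).
transitivity (\esum_(la in [set: strict_partition]) \esum_(nu in [set: strict_partition])
    (skew_sum X nu mu * (one_var 2 1 x la nu * Defs.Pfun la Y))%:E)%E.
  apply: eq_esum => la _ /=; rewrite mulr_suml.
  rewrite (@esum_finite _ _ (partitions (head 0%N la))) ?uniq_partitions //.
  - by congr (_%:E); apply: eq_bigr => nu _; ring.
  - by move=> nu; do ?[exact: t0|exact: s0|exact: P0|apply: mulr_ge0].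
  - by move=> nu; rewrite mem_partitions -ltnNge => /one_var0 ->; rewrite mul0r mulr0.
rewrite esum_exchange; last first.
  by move=> *; do ?[exact: t0|exact: s0|exact: P0|apply: mulr_ge0].
transitivity (\esum_(nu in [set: strict_partition])
    (h * (skew_sum X nu mu * Defs.Pfun nu Y))%:E)%E.
  apply: eq_esum => nu _; rewrite (esum_scale _ _ (one_var_Cauchy nu x0 Y0 xY1)) //.
    by congr (_%:E); rewrite -/h; ring.
  by move=> la; exact: mulr_ge0.
by rewrite (esum_scale h0 _ IHX) ?mulrA // => nu; exact: mulr_ge0.
Qed.

End SkewCauchy.

(** * The measure and its Markov kernel *)

Theorem theorem5p3 (R : realType) (q : R) (X Y : seq R)
    (q_ge0 : 0 <= q)
    (X_ge0 : forall x, x \in X -> 0 <= x)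
    (Y_ge0 : forall y, y \in Y -> 0 <= y)
    (XY_lt1 : forall x y, x \in X -> y \in Y -> Num.max 1 q * (x * y) < 1) :
  [/\ is_prob_mass (fun z : strict_partition * strict_partition =>
        Pq q X Y z.1 z.2),
      forall mu : strict_partition, pi_dist q X Y mu != 0 ->
        (forall la, 0 <= Kker X Y mu la) /\
        (\esum_(la in [set: strict_partition]) (Kker X Y mu la)%:E = 1)%E
    & forall mu la : strict_partition,
        Pq q X Y mu la = pi_dist q X Y mu * Kker X Y mu la].
Proof.
set qX := scale_alphabet q X.
have qX_ge0 x : x \in qX -> 0 <= x.
  by move=> /mapP[x' xX ->]; exact: mulr_ge0 q_ge0 (X_ge0 _ xX).
have xy_ge0 x y : x \in X -> y \in Y -> 0 <= x * y.
  by move=> xX yY; exact: mulr_ge0 (X_ge0 _ xX) (Y_ge0 _ yY).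
have XY1 x y : x \in X -> y \in Y -> x * y < 1.
  move=> xX yY; apply: le_lt_trans (XY_lt1 _ _ xX yY); rewrite -[leLHS]mul1r.
  by rewrite ler_wpM2r ?xy_ge0 // le_max lexx.
have qXY1 x y : x \in qX -> y \in Y -> x * y < 1.
  move=> /mapP[x' xX ->] yY; apply: le_lt_trans (XY_lt1 _ _ xX yY); rewrite -mulrA.
  by rewrite ler_wpM2r ?xy_ge0 // le_max lexx orbT.
have H_neq0 A B : Hker A B != 0 :> R by rewrite gt_eqF // expR_gt0.
have H_ge0 A B : 0 <= Hker A B :> R by exact: expR_ge0.
have P_ge0 la : 0 <= Defs.Pfun la Y by exact: Pfun_ge0.
have S_ge0 la mu : 0 <= skewQ la mu X by rewrite skewQE skew_sum_ge0.
have Q_ge0 mu : 0 <= Qfun mu qX by rewrite Qfun_skew skew_sum_ge0.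
have SP_ge0 mu la : 0 <= skewQ la mu X * Defs.Pfun la Y by exact: mulr_ge0.
have Cauchy mu := skew_Cauchy mu X_ge0 Y_ge0 XY1.
have skew0 la mu : ~ contained mu la -> skewQ la mu X = 0.
  by move=> mu_la; rewrite skewQE skew_sum_contained.
have KE mu la : Kker X Y mu la =
    (Hker X Y * Defs.Pfun mu Y)^-1 * (skewQ la mu X * Defs.Pfun la Y).
  rewrite /Kker; case: asboolP => [_|/skew0 ->]; first by rewrite mulrC.
  by rewrite mul0r mulr0.
have PqE mu la : Pq q X Y mu la =
    Qfun mu qX / (Hker qX Y * Hker X Y) * (skewQ la mu X * Defs.Pfun la Y).
  rewrite /Pq -/qX; case: asboolP => [_|/skew0 ->]; last by rewrite mul0r mulr0.
  by rewrite -[_ * skewQ _ _ _ * _]mulrA mulrAC.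
split.
- split=> [[mu la]|].
    rewrite PqE; apply: mulr_ge0 => //; apply: divr_ge0 => //; exact: mulr_ge0.
  have PqT : (\esum_(t in [set: strict_partition * strict_partition])
                (Pq q X Y t.1 t.2)%:E =
     \esum_(mu in [set: strict_partition]) \esum_(la in [set: strict_partition])
                (Pq q X Y mu la)%:E)%E.
    rewrite esum_esum; last first.
      move=> mu la _ _; rewrite lee_fin PqE.
      by apply: mulr_ge0 => //; apply: divr_ge0 => //; exact: mulr_ge0.
    by congr esum; apply/seteqP.
  rewrite PqT.
  transitivity (\esum_(mu in [set: strict_partition])
      ((Hker qX Y)^-1 * (skewQ mu empty_partition qX * Defs.Pfun mu Y))%:E)%E.
    apply: eq_esum => mu _; under eq_esum do rewrite PqE.
    rewrite (esum_scale _ _ (Cauchy mu)) //; last by apply: divr_ge0 => //; exact: mulr_ge0.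
    rewrite skewQE -Qfun_skew; congr (_%:E); field.
    by rewrite !H_neq0.
  have qP_ge0 mu : 0 <= skewQ mu empty_partition qX * Defs.Pfun mu Y.
    by apply: mulr_ge0 => //; rewrite skewQE skew_sum_ge0.
  rewrite (esum_scale _ qP_ge0 (skew_Cauchy empty_partition qX_ge0 Y_ge0 qXY1)).
    by rewrite Pfun_empty mulr1 mulVf.
  by rewrite invr_ge0.
- move=> mu pi_neq0; have P_neq0 : Defs.Pfun mu Y != 0.
    by apply: contraNneq pi_neq0 => P0; rewrite /pi_dist P0 mulr0 mul0r.
  have HP_ge0 : 0 <= (Hker X Y * Defs.Pfun mu Y)^-1 by rewrite invr_ge0 mulr_ge0.
  split=> [la|]; first by rewrite KE mulr_ge0.
  under eq_esum do rewrite KE.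
  rewrite (esum_scale HP_ge0 (SP_ge0 mu) (Cauchy mu)) mulVf //.
  by rewrite mulf_neq0.
- move=> mu la; rewrite PqE KE /pi_dist -/qX.
  (* If [P_mu(Y) = 0], the Cauchy sum is 0 and so are all its terms. *)
  have [P0|P_neq0] := eqVneq (Defs.Pfun mu Y) 0; last first.
    by field; rewrite !H_neq0 P_neq0.
  have /esum0_eq0 -> // : (\esum_(la in [set: strict_partition])
     (skewQ la mu X * Defs.Pfun la Y)%:E = 0)%E by rewrite Cauchy P0 mulr0.
  by rewrite !mulr0.
Qed.
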